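(* There is an automorphism $T:\ell_\infty/c_0\rightarrow\ell_\infty/c_0$ which cannot be lifted to a linear operator on $\ell_\infty$; that is, there is no bounded linear operator $R:\ell_\infty\to\ell_\infty$ with $R[c_0]\subseteq c_0$ and $T([f])=[R(f)]$ for all $f\in\ell_\infty$.
   Context: $[f]$ denotes the class of $f\in\ell_\infty$ modulo $c_0$. An automorphism of $\ell_\infty/c_0$ is a bounded linear bijection of the Banach space $\ell_\infty/c_0$ onto itself (with bounded inverse). *)

(* Defs.v *)
From HB Require Import structures.
From mathcomp Require Import all_boot all_order all_algebra.
From mathcomp Require Import all_classical all_reals.
From mathcomp Require Import topology normedtype sequences.

Set Implicit Arguments.
Unset Strict Implicit.
Unset Printing Implicit Defensive.

Import Order.TTheory GRing.Theory Num.Theory.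
Import numFieldNormedType.Exports.

Local Open Scope classical_set_scope.
Local Open Scope ring_scope.
Local Open Scope quotient_scope.

Section BoundedSequences.
Context (R : realType).

Definition bounded_seq : {pred nat -> R} :=
  mem [set u : nat -> R | bounded_fun u].

Lemma bounded_seqP (u : nat -> R) :
  reflect (exists M : R, forall n, `|u n| <= M) (u \in bounded_seq).
Proof.
apply: (iffP idP) => [/set_mem ub|[M uM]].
  have PF : ProperFilter (globally [set: nat]).
    exact: (globally_properfilter (I : setT 0%N)).
  by have [M uM] := (ex_bound u).1 ub; exists M => n; exact: uM.
apply: mem_set; exists M; split; first exact: num_real.
by move=> x Mx n _; exact: le_trans (uM n) (ltW Mx).
Qed.

Lemma bounded_seq_submod_closed : submod_closed bounded_seq.
Proof.
split; first by apply/bounded_seqP; exists 0 => n; rewrite normr0.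
move=> a u v /bounded_seqP[M uM] /bounded_seqP[N vN]; apply/bounded_seqP.
exists (`|a| * M + N) => n; apply: le_trans (ler_normD _ _) _.
by rewrite lerD// normrM ler_wpM2l.
Qed.

HB.instance Definition _ :=
  GRing.isSubmodClosed.Build R (nat -> R) bounded_seq bounded_seq_submod_closed.

Record linf := Linf { linf_val :> nat -> R; _ : linf_val \in bounded_seq }.

HB.instance Definition _ := [isSub for linf_val].
HB.instance Definition _ := [Choice of linf by <:].
HB.instance Definition _ := [SubChoice_isSubLmodule of linf by <:].

Definition linf_norm (u : linf) : R := sup (range (fun n => `|u n|)).

Lemma linf_has_sup (u : linf) : has_sup (range (fun n => `|u n|)).
Proof.
split; first by exists `|u 0%N|; exists 0%N.
by case/bounded_seqP: (valP u) => M uM; exists M => _ [n _ <-]; exact: uM.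
Qed.

Lemma linf_norm_ub (u : linf) n : `|u n| <= linf_norm u.
Proof. by apply: sup_upper_bound; [exact: linf_has_sup|exists n]. Qed.

Lemma linf_norm_le (u : linf) M : (forall n, `|u n| <= M) -> linf_norm u <= M.
Proof.
move=> uM; apply: ge_sup; first by case: (linf_has_sup u).
by move=> _ [n _ <-].
Qed.

Lemma linf_normD u v : linf_norm (u + v) <= linf_norm u + linf_norm v.
Proof.
apply: linf_norm_le => n; apply: le_trans (ler_normD _ _) _.
by rewrite lerD ?linf_norm_ub.
Qed.

Lemma linf_normZ (a : R) u : linf_norm (a *: u) = `|a| * linf_norm u.
Proof.
apply/eqP; rewrite eq_le; apply/andP; split.
  by apply: linf_norm_le => n; rewrite normrM ler_wpM2l ?linf_norm_ub.
have [->|a0] := eqVneq a 0.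
  by rewrite normr0 mul0r; apply: le_trans (linf_norm_ub _ 0%N).
rewrite -ler_pdivlMl ?normr_gt0//; apply: linf_norm_le => n.
rewrite ler_pdivlMl ?normr_gt0// -normrM.
exact: (linf_norm_ub (a *: u) n).
Qed.

Lemma linf_norm0_eq0 u : linf_norm u = 0 -> u = 0.
Proof.
move=> u0; apply/val_inj/funext => n; apply/normr0_eq0/eqP.
by rewrite -normr_le0 -u0 normr_id linf_norm_ub.
Qed.

HB.instance Definition _ :=
  Lmodule_isNormed.Build R linf linf_normD linf_normZ linf_norm0_eq0.

Definition c0 : {pred linf} :=
  mem [set u : linf | u n @[n --> \oo] --> (0 : R)].

Lemma c0_submod_closed : submod_closed c0.
Proof.
split; first by apply: mem_set; exact: cvg_cst.
move=> a u v /set_mem u0 /set_mem v0; apply: mem_set => /=.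
rewrite -[0 : R]addr0 -{1}(mulr0 a); apply: cvgD => //.
by apply: cvgM => //; exact: cvg_cst.
Qed.

HB.instance Definition _ :=
  GRing.isSubmodClosed.Build R linf c0 c0_submod_closed.

Definition linf_c0 : Type := Quotient.quot c0.

HB.instance Definition _ := GRing.Zmodule.on linf_c0.
HB.instance Definition _ := EqQuotient.on linf_c0.

Definition class_c0 (u : linf) : linf_c0 := \pi_(linf_c0) u.

Lemma class_c0P u v : reflect (class_c0 u = class_c0 v) (u - v \in c0).
Proof.
by rewrite (Quotient.idealrBE c0 u v); exact: eqP.
Qed.

Lemma class_c0_surj (x : linf_c0) : exists u, class_c0 u = x.
Proof. by exists (repr x); exact: reprK. Qed.

Lemma class_c0D : {morph class_c0 : u v / u + v}.
Proof. exact: (raddfD (\pi_(Quotient.quot c0))). Qed.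

Definition linf_c0_scale (a : R) (x : linf_c0) : linf_c0 :=
  class_c0 (a *: repr x).

Lemma class_c0Z a u : linf_c0_scale a (class_c0 u) = class_c0 (a *: u).
Proof.
apply/class_c0P; rewrite -scalerBr rpredZ//.
by apply/class_c0P; exact: reprK.
Qed.

Fact linf_c0_scaleA a b x :
  linf_c0_scale a (linf_c0_scale b x) = linf_c0_scale (a * b) x.
Proof. by case: (class_c0_surj x) => u <-; rewrite !class_c0Z scalerA. Qed.

Fact linf_c0_scale1 : left_id 1 linf_c0_scale.
Proof. by move=> x; case: (class_c0_surj x) => u <-; rewrite class_c0Z scale1r. Qed.

Fact linf_c0_scaleDr : right_distributive linf_c0_scale +%R.
Proof.
move=> a x y; case: (class_c0_surj x) (class_c0_surj y) => u <- [v <-].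
by rewrite -class_c0D !class_c0Z scalerDr class_c0D.
Qed.

Fact linf_c0_scaleDl x : {morph linf_c0_scale^~ x : a b / a + b}.
Proof.
move=> a b; case: (class_c0_surj x) => u <-.
by rewrite !class_c0Z scalerDl class_c0D.
Qed.

HB.instance Definition _ := GRing.Zmodule_isLmodule.Build R linf_c0
  linf_c0_scaleA linf_c0_scale1 linf_c0_scaleDr linf_c0_scaleDl.

Fact class_c0_is_linear : linear class_c0.
Proof. by move=> a u v; rewrite class_c0D -class_c0Z. Qed.

HB.instance Definition _ :=
  GRing.isLinear.Build R linf linf_c0 _ class_c0 class_c0_is_linear.

Definition linf_c0_norm (x : linf_c0) : R :=
  inf [set `|u| | u in [set u : linf | class_c0 u = x]].

Lemma linf_c0_norm_lb u : linf_c0_norm (class_c0 u) <= `|u|.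
Proof. by apply: ge_inf; [exists 0 => _ [v _ <-]|exists u]. Qed.

Lemma linf_c0_norm_approx x (e : R) : 0 < e ->
  exists2 u, class_c0 u = x & `|u| < linf_c0_norm x + e.
Proof.
move=> e0; have [|_ [u ux <-] uxe] := @inf_adherent _
    [set `|u| | u in [set u : linf | class_c0 u = x]] e e0; last by exists u.
split; last by exists 0 => _ [v _ <-].
by case: (class_c0_surj x) => u ux; exists `|u|, u.
Qed.

Lemma linf_c0_normD x y :
  linf_c0_norm (x + y) <= linf_c0_norm x + linf_c0_norm y.
Proof.
apply/ler_addgt0Pr => e e0; have e20 : 0 < e / 2 by rewrite divr_gt0.
have [u <- ue] := linf_c0_norm_approx x e20.
have [v <- ve] := linf_c0_norm_approx y e20.
rewrite -linearD; apply: le_trans (linf_c0_norm_lb _) _.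
apply: le_trans (ler_normD _ _) _; apply: le_trans (lerD (ltW ue) (ltW ve)) _.
by rewrite addrACA -splitr.
Qed.

Lemma linf_c0_norm_scale_le (a : R) x :
  linf_c0_norm (a *: x) <= `|a| * linf_c0_norm x.
Proof.
apply/ler_addgt0Pr => e e0.
have d0 : 0 < e / (`|a| + 1) by rewrite divr_gt0// ltr_wpDl.
have [u ux ue] := linf_c0_norm_approx x d0.
rewrite -{1}ux -linearZ; apply: le_trans (linf_c0_norm_lb _) _.
rewrite normrZ; apply: le_trans (ler_wpM2l (normr_ge0 a) (ltW ue)) _.
rewrite mulrDr lerD2l mulrCA ger_pMr// ler_pdivrMr ?ltr_wpDl//.
by rewrite mul1r lerDl.
Qed.

Lemma linf_c0_normZ (a : R) x : linf_c0_norm (a *: x) = `|a| * linf_c0_norm x.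
Proof.
apply/eqP; rewrite eq_le linf_c0_norm_scale_le/=.
have [->|a0] := eqVneq a 0.
  rewrite normr0 mul0r; apply: lb_le_inf; last by move=> _ [v _ <-].
  by case: (class_c0_surj (0 *: x)) => u ux; exists `|u|, u.
rewrite -ler_pdivlMl ?normr_gt0// -normfV.
by apply: le_trans (linf_c0_norm_scale_le _ _); rewrite scalerA mulVf// scale1r.
Qed.

Lemma linf_c0_norm0_eq0 x : linf_c0_norm x = 0 -> x = 0.
Proof.
move=> x0; case: (class_c0_surj x) => u ux.
rewrite -ux -[RHS](linear0 class_c0); apply/class_c0P; rewrite subr0.
apply: mem_set; apply/cvgr0Pnorm_lt => e e0.
have e20 : 0 < e / 2 by rewrite divr_gt0.
have [v vx] := linf_c0_norm_approx x e20; rewrite x0 add0r => ve.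
have /class_c0P/set_mem/cvgr0Pnorm_lt/(_ _ e20) : class_c0 u = class_c0 v.
  by rewrite ux vx.
apply: filterS => n uvn; rewrite -[u n](subrK (v n)).
apply: le_lt_trans (ler_normD _ _) _; rewrite [ltRHS]splitr ltrD//.
exact: le_lt_trans (linf_norm_ub v n) ve.
Qed.

HB.instance Definition _ := Lmodule_isNormed.Build R linf_c0
  linf_c0_normD linf_c0_normZ linf_c0_norm0_eq0.

End BoundedSequences.

Arguments c0 {R}.
Arguments class_c0 {R}.

Definition bounded_operator (R : realType) (V W : normedModType R)
    (T : {linear V -> W}) : Prop :=
  exists C : R, forall x : V, `|T x| <= C * `|x|.

Definition automorphism (R : realType) (V : normedModType R)
    (T : {linear V -> V}) : Prop :=
  bounded_operator T /\
  exists S : {linear V -> V}, [/\ bounded_operator S, cancel T S & cancel S T].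

(* Main.v *)
Require Import Defs.
From HB Require Import structures.
From mathcomp Require Import all_boot all_order all_algebra.
From mathcomp Require Import all_classical all_reals.
From mathcomp Require Import topology normedtype sequences.
From mathcomp Require Import ring lra.

(** The automorphism is [1 + S] for a bounded operator [S] with [S^2 = 0]: its
    inverse is [1 - S], and if [L] lifts [1 + S] then [L - 1] lifts [S].  So the
    point is to find such an [S] that does not lift.

    Construction of [S].  Code the finite binary strings by integers, in two
    disjoint copies.  Averaging a bounded sequence over the strings of length [n]
    of the first copy, and taking the limit in [n] along a free ultrafilter,
    gives a positive mean [lam] that vanishes on [c0].  The Walsh functions
    [w_a], one for each infinite binary sequence [a], are orthonormal for [lam].
    By Bessel's inequality ([bessel]) the coefficients [lam (f w_a)] tend to zero
    along the uncountable set of indices, and all are at most the square root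
    of [lam (f^2)].  In the second copy, the initial segments of [a] form an
    infinite set [B_a], and these branches are almost disjoint.  Hence
      S [f] = sum over a of lam (f w_a) [1_(B_a)]
    makes sense modulo [c0] ([spread_linear]).  As [lam] does not see the second
    copy, [S^2 = 0].

    Why [S] does not lift.  A lift [L] is a sequence of functionals
    [f |-> (L f) n] on the bounded sequences, whose total variations [V_n] are
    finitely additive.  Three facts contradict each other.

    - The [V_n] are uniformly exhaustive: they tend to zero, uniformly in [n],
      along disjoint sets ([variation_exhaustive]).  Otherwise Rosenthal's
      disjointification lemma ([rosenthal]) gives [f] supported on a set of small
      [lam] mass such that [(L f) n] stays large for infinitely many [n], while
      [S [f]] is small.  This says that [L] is weakly compact.
    - Therefore one positive functional [m], the weighted sum of the [V_n],
      controls all of them at once ([exhaustive_control]), so that [L h] is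
      uniformly small when [h] is bounded and [m (h^2)] is small
      ([exhaustive_small]).
    - There are more sequences [a] than finite rational data, so some [L w_a] is
      a coordinatewise limit of [L w_b] with [b <> a] ([sequence_cluster]).  The
      differences [w_b - w_a] have images under [L] tending to [0] at each
      coordinate but to [-1] along [B_a].

    All these properties of the differences survive convex combinations, so
    Mazur's lemma for the quadratic form [m (h^2)] ([mazur]) yields an [h] that
    is [m]-close to admissible [h'] arbitrarily far in the sequence.  By the
    control of [L] by [m], [L h] is small at every coordinate, although it tends
    to [-1] along [B_a]. *)

Set Implicit Arguments.
Unset Strict Implicit.
Unset Printing Implicit Defensive.

Import Order.TTheory GRing.Theory Num.Theory.
Import numFieldNormedType.Exports.

Local Open Scope classical_set_scope.
Local Open Scope ring_scope.

(** * Finitely additive set functions *)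
Section Contents.
Context (R : realType).
Implicit Types (mu : set nat -> R) (A B : set nat).

(** Bounded finitely additive set functions.  Additivity is stated as two
    inequalities with a free outer set, which spares set identities in use. *)
Definition is_content (C : R) mu :=
  [/\ forall A, 0 <= mu A <= C,
      forall A B D, A `<=` B `|` D -> mu A <= mu B + mu D
    & forall A B D, (forall k, A k -> B k -> False) ->
        A `|` B `<=` D -> mu A + mu B <= mu D].

Definition pairwise_disj (D : nat -> set nat) :=
  forall i j k, D i k -> D j k -> i = j.

Lemma content0 C mu : is_content C mu -> mu set0 = 0.
Proof.
case=> b _ /(_ set0 set0 set0) H.
have := b set0 => /andP[h _].
suff : mu set0 + mu set0 <= mu set0 by move=> h2; lra.
by apply: H => //; rewrite setU0.
Qed.

Lemma content_mono C mu A B : is_content C mu -> A `<=` B -> mu A <= mu B.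
Proof.
move=> cmu AB; have [_ sub _] := cmu.
have := sub A B set0; rewrite setU0 (content0 cmu) addr0; exact.
Qed.

(** The values on the first [n] sets add up to at most [C], whatever [n]. *)
Lemma content_small C mu (E : nat -> set nat) (e : R) :
  is_content C mu -> pairwise_disj E -> 0 < e -> exists p, mu (E p) <= e.
Proof.
move=> cmu dE e0; apply: contrapT => /forallNP nE.
have big p : e < mu (E p) by rewrite ltNge; apply/negP/nE.
have [bd _ sup] := cmu.
have sum n : n%:R * e <= mu [set k | exists2 p, (p < n)%N & E p k].
  elim: n => [|n IH].
    by rewrite mul0r; case/andP: (bd [set k | exists2 p, (p < 0)%N & E p k]).
  rewrite -natr1 mulrDl mul1r; apply: le_trans (lerD IH (ltW (big n))) _.
  apply: sup => [k [p pn Ep] En|k [[p pn Ep]|En]].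
  - by have := dE _ _ _ Ep En => pe; rewrite pe ltnn in pn.
  - by exists p => //; apply: ltnW.
  - by exists n.
pose n := (Num.truncn (C / e)).+1.
have /andP[_ Cn] := bd [set k | exists2 p, (p < n)%N & E p k].
have := le_trans (sum n) Cn; rewrite -ler_pdivlMr// leNgt.
by rewrite truncnS_gt.
Qed.

(** Rosenthal's disjointification lemma.  Choose infinitely many disjoint
    infinite rows of indices.  Either one row works, or each row [p] contains an
    index, its [f p]-th one, whose content gives mass at least [e] to the rest of
    the row.  Keeping only these indices then lowers the mass of the whole union, seen by each
    remaining content, by [e].  This can happen only [C / e] times, which is the
    induction on [m]. *)
Lemma rosenthal C (e : R) (M : nat -> set nat -> R) (D : nat -> set nat) :
  (forall i, is_content C (M i)) -> pairwise_disj D -> 0 < e ->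
  exists2 s : nat -> nat, injective s &
    forall i, M (s i) [set k | exists2 j, j <> i & D (s j) k] < e.
Proof.
move=> cM dD e0.
suff gen m : forall M D, (forall i, is_content C (M i)) -> pairwise_disj D ->
    (forall i, M i [set k | exists j, D j k] <= m%:R * e) ->
    exists2 s : nat -> nat, injective s &
      forall i, M (s i) [set k | exists2 j, j <> i & D (s j) k] < e.
  apply: (gen (Num.truncn (C / e)).+1 M D) => // i.
  have [/(_ [set k | exists j, D j k])/andP[_ bi] _ _] := cM i.
  by apply: le_trans bi _; rewrite -ler_pdivrMr//; apply/ltW/truncnS_gt.
elim: m {M D cM dD} => [|m IH] M D cM dD bM.
  exists id => [//|i]; apply: le_lt_trans e0.
  rewrite -(mul0r e); apply: le_trans (bM i); apply: (content_mono (cM i)).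
  by move=> k [j _ Dj]; exists j.
pose c (p j : nat) : nat := pickle (p, j).
have c_inj p j p' j' : c p j = c p' j' -> p = p' /\ j = j'.
  by move=> /(pcan_inj (@pickleK _)) [].
have [[p pP]|/forallNP nP] := pselect (exists p, forall i,
    M (c p i) [set k | exists2 j, j <> i & D (c p j) k] < e).
  by exists (c p) => // i j /c_inj[].
have /choice[f fP] p : exists i,
    e <= M (c p i) [set k | exists2 j, j <> i & D (c p j) k].
  have /existsNP[i /negP] := nP p.
  by rewrite -leNgt => ?; exists i.
have [|i j k|i|s s_inj sP] := IH (fun p => M (c p (f p))) (fun p => D (c p (f p))).
- by move=> i; apply: cM.
- by move=> /dD H /H /c_inj[].
- have [_ _ sup] := cM (c i (f i)).
  have : M (c i (f i)) [set k | exists j, D (c j (f j)) k]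
      + M (c i (f i)) [set k | exists2 j, j <> f i & D (c i j) k]
      <= M (c i (f i)) [set k | exists j, D j k].
    apply: sup => [k [j Dj] [j' jf Dj']|k [[j Dj]|[j _ Dj]]].
    + by have /c_inj[ji] := dD _ _ _ Dj Dj'; rewrite ji => /esym.
    + by exists (c j (f j)).
    + by exists (c i j).
  have := bM (c i (f i)); have := fP i; rewrite -natr1; lra.
exists (fun i => c (s i) (f (s i))) => [i j /c_inj[/s_inj]//|i].
exact: sP.
Qed.

(** A single small term is enough, since the sequence [D] may be replaced by any
    of its subsequences. *)
Definition uniformly_exhaustive (V : nat -> set nat -> R) :=
  forall (D : nat -> set nat) (e : R), pairwise_disj D -> 0 < e ->
  exists i, forall n, V n (D i) <= e.

(** If the differences did not become small, consecutive differences along a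
    subsequence would be disjoint and uniformly large. *)
Lemma exhaustive_decreasing V (E : nat -> set nat) (e : R) :
  uniformly_exhaustive V ->
  (forall i j, (i <= j)%N -> E j `<=` E i) -> 0 < e ->
  exists i, forall j n, (i <= j)%N -> V n (E i `\` E j) <= e.
Proof.
move=> exV dE e0; apply: contrapT => /forallNP nE.
have /choice[f fP] i : exists j, (i <= j)%N /\ exists n, e < V n (E i `\` E j).
  have /existsNP[j /existsNP[n /not_implyP[ij /negP]]] := nE i.
  by rewrite -ltNge => ?; exists j; split=> //; exists n.
pose s := fix s n := if n is n'.+1 then f (s n') else 0%N.
have ms i j : (i <= j)%N -> (s i <= s j)%N.
  elim: j => [|j IH]; first by rewrite leqn0 => /eqP->.
  rewrite leq_eqVlt => /orP[/eqP->//|]; rewrite ltnS => /IH h.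
  by apply: leq_trans h _; have [] := fP (s j).
have dis i j k : (i < j)%N -> (E (s i) `\` E (s i.+1)) k ->
    (E (s j) `\` E (s j.+1)) k -> False.
  by move=> ij [_ h1] [h2 _]; apply: h1; apply: dE h2; apply: ms.
have [|i iP] := exV (fun i => E (s i) `\` E (s i.+1)) e _ e0.
  move=> i j k Ei Ej; have [ij|ij|//] := ltngtP i j.
  - by case: (dis _ _ _ ij Ei Ej).
  - by case: (dis _ _ _ ij Ej Ei).
have [_ [n nP]] := fP (s i).
by have := lt_le_trans nP (iP n); rewrite ltxx.
Qed.

Lemma exhaustive_increasing V (E : nat -> set nat) (e : R) :
  uniformly_exhaustive V ->
  (forall i j, (i <= j)%N -> E i `<=` E j) -> 0 < e ->
  exists i, forall j n, (i <= j)%N -> V n (E j `\` E i) <= e.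
Proof.
move=> exV iE e0.
have [|i iP] := exhaustive_decreasing (E := fun i => ~` E i) exV _ e0.
  by move=> i j ij; apply: subsetC; apply: iE.
exists i => j n ij; have := iP j n ij.
by rewrite !setDE setCK setIC.
Qed.

Lemma pow2_small (K e : R) : 0 < e ->
  exists j0, forall j, (j0 <= j)%N -> K / 2 ^+ j < e.
Proof.
move=> e0; exists (Num.truncn (K / e)).+1 => j jK.
rewrite ltr_pdivrMr ?exprn_gt0// mulrC -ltr_pdivrMr//.
apply: lt_le_trans (truncnS_gt _) _; rewrite -natrX ler_nat.
by apply: leq_trans jK _; apply/ltnW/ltn_expl.
Qed.

(** A form of the Vitali-Hahn-Saks theorem: smallness of each [V n] along [E]
    becomes uniform in [n].  For lack of countable additivity, the tail unions of
    the [E j] are replaced by finite unions [G a], chosen by exhaustivity so that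
    later terms of the union add little.  If every [E j] were large for some [n],
    so would be the decreasing intersections [KK i] of the [G a].  Exhaustivity
    makes a single [n] work for all large [i], while for fixed [n] the mass
    of [G a] is at most a geometric tail. *)
Lemma exhaustive_control C V (K : nat -> R) (E : nat -> set nat) (e : R) :
  (forall n, is_content C (V n)) -> uniformly_exhaustive V ->
  (forall n i, V n (E i) <= K n / 2 ^+ i) -> 0 < e ->
  exists i, forall n, V n (E i) <= e.
Proof.
move=> cV exV EK e0; apply: contrapT => /forallNP nE.
have /choice[nn nnP] i : exists n, e < V n (E i).
  have /existsNP[n /negP] := nE i.
  by rewrite -ltNge => ?; exists n.
pose H a q := [set k | exists2 j, (a <= j <= q)%N & E j k].
have p2 i : 0 < 2 ^+ i :> R by rewrite exprn_gt0.
have /choice[p pP] a : exists p, forall q n, (p <= q)%N ->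
    V n (H a q `\` H a p) <= e / 2 ^+ a.+2.
  apply: exhaustive_increasing => //; last by rewrite divr_gt0.
  move=> i j ij k [t /andP[h1 h2] Et]; exists t => //.
  by rewrite h1 (leq_trans h2).
pose G a := H a (p a).
pose KK i := [set k | forall a, (a <= i)%N -> G a k].
have EG j a n : (a <= j)%N -> (p a <= j)%N -> V n (E j `\` G a) <= e / 2 ^+ a.+2.
  move=> aj paj; apply: le_trans (pP a j n paj); apply: (content_mono (cV n)).
  by move=> k [Ej nG]; split=> //; exists j => //; rewrite aj leqnn.
have EKK j n i : (forall a, (a <= i)%N -> (a <= j)%N /\ (p a <= j)%N) ->
    V n (E j `\` KK i) <= e / 2 * (1 - (2 ^+ i.+1)^-1).
  elim: i => [|i IH] h.
    have [h1 h2] := h 0%N (leqnn 0).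
    have := EG j 0%N n h1 h2; rewrite expr2 expr1.
    suff : V n (E j `\` KK 0) <= V n (E j `\` G 0%N) by lra.
    apply: (content_mono (cV n)) => k [Ej nK]; split=> // G0; apply: nK => a.
    by rewrite leqn0 => /eqP->.
  have [h1 h2] := h i.+1 (leqnn _).
  have := EG j _ n h1 h2.
  have := IH (fun a ai => h a (leqW ai)).
  have [_ sub _] := cV n.
  have : V n (E j `\` KK i.+1) <= V n (E j `\` KK i) + V n (E j `\` G i.+1).
    apply: sub => k [Ej nK].
    have [Gi|nG] := pselect (G i.+1 k); last by right.
    left; split=> // Ki; apply: nK => a; rewrite leq_eqVlt => /orP[/eqP->//|].
    by rewrite ltnS; apply: Ki.
  have -> : e / 2 ^+ i.+3 = e / 2 * ((2 ^+ i.+1)^-1 / 2).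
    by rewrite !exprS !invfM; ring.
  have -> : (2 ^+ i.+2)^-1 = (2 ^+ i.+1)^-1 / 2 :> R.
    by rewrite !exprS !invfM; ring.
  by set t := (2 ^+ i.+1)^-1; lra.
have Kbig i : exists n, e / 2 < V n (KK i).
  pose j := (i + \max_(a < i.+1) p a)%N.
  have jP a : (a <= i)%N -> (a <= j)%N /\ (p a <= j)%N.
    move=> ai; split; first exact: leq_trans ai (leq_addr _ _).
    apply: leq_trans (leq_addl _ _).
    exact: (@leq_bigmax _ (fun a : 'I_i.+1 => p a) (Ordinal (ai : (a < i.+1)%N))).
  exists (nn j); have := nnP j; have := EKK j (nn j) i jP.
  have [_ sub _] := cV (nn j).
  have : V (nn j) (E j) <= V (nn j) (KK i) + V (nn j) (E j `\` KK i).
    by apply: sub => k Ej; have [|] := pselect (KK i k); [left|right].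
  have : 0 < e * (2 ^+ i.+1)^-1 by rewrite divr_gt0.
  by set t := (2 ^+ i.+1)^-1; lra.
have e4 : 0 < e / 4 by rewrite divr_gt0.
have [|i iP] := exhaustive_decreasing (E := KK) exV _ e4.
  by move=> i j ij k Kk a ai; apply: Kk; apply: leq_trans ij.
have [n nK] := Kbig i.
have lowK j : (i <= j)%N -> e / 4 < V n (KK j).
  move=> ij; have := iP j n ij; have [_ sub _] := cV n.
  have : V n (KK i) <= V n (KK j) + V n (KK i `\` KK j).
    by apply: sub => k Ek; have [|] := pselect (KK j k); [left|right].
  lra.
have K0 : 0 <= K n.
  have [/(_ (E 0%N))/andP[h _] _ _] := cV n.
  by have := EK n 0%N; rewrite expr0 divr1; apply: le_trans.
have HK j d : V n (H j (j + d)%N) <= K n * (2 / 2 ^+ j - (2 ^+ (j + d))^-1).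
  elim: d => [|d IH].
    rewrite addn0; apply: le_trans (le_trans (EK n j) _).
      apply: (content_mono (cV n)) => k [t /andP[h1 h2]].
      by have -> : t = j by apply/eqP; rewrite eqn_leq h1 h2.
    by rewrite le_eqVlt; apply/orP; left; apply/eqP; ring.
  have [_ sub _] := cV n.
  have : V n (H j (j + d.+1)%N) <= V n (H j (j + d)%N) + V n (E (j + d.+1)%N).
    apply: sub => k [t /andP[h1 h2] Et]; move: h2; rewrite leq_eqVlt.
    case/orP => [/eqP<-|h2]; [by right|left; exists t => //].
    by rewrite h1 -ltnS -addnS.
  have := EK n (j + d.+1)%N.
  move: IH; have -> : (2 ^+ (j + d))^-1 = 2 * (2 ^+ (j + d.+1))^-1 :> R.
    by rewrite addnS exprS invfM mulrA divff ?mul1r ?pnatr_eq0.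
  set t := (2 ^+ (j + d.+1))^-1; lra.
have [j0 j0P] := pow2_small (K n * 2) e4.
pose j := maxn i j0.
have := lowK j (leq_maxl _ _); have := j0P j (leq_maxr _ _).
have : V n (KK j) <= V n (H j (j + p j)%N).
  apply: (content_mono (cV n)) => k /(_ j (leqnn j)) [t /andP[h1 h2] Et].
  by exists t => //; rewrite h1 (leq_trans h2)// leq_addl.
have := HK j (p j).
have : 0 <= K n * (2 ^+ (j + p j))^-1 by rewrite mulr_ge0// invr_ge0 ltW.
set t := _^-1; lra.
Qed.

End Contents.

(** * Positive functionals on bounded sequences *)
Section Positive.
Context (R : realType).
Implicit Types (f g : nat -> R) (h x : linf R).

Definition bounded_nonneg f := exists M, forall k, 0 <= f k <= M.

(** Only nonnegative arguments are constrained: total variations and quadratic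
    forms need nothing else. *)
Definition is_positive (C : R) (v : (nat -> R) -> R) :=
  (forall f g, bounded_nonneg f -> bounded_nonneg g ->
     v (fun k => f k + g k) = v f + v g) /\
  (forall f M, (forall k, 0 <= f k <= M) -> 0 <= v f <= C * M).

Definition char (A : set nat) (k : nat) : R := (`[< A k >])%:R.

Lemma charT (A : set nat) k : A k -> char A k = 1.
Proof. by rewrite /char => /asboolT ->. Qed.

Lemma charF (A : set nat) k : ~ A k -> char A k = 0.
Proof. by rewrite /char => /asboolF ->. Qed.

Lemma char01 (A : set nat) k : 0 <= char A k <= 1.
Proof. by rewrite /char; case: asboolP => _; rewrite /= ?lexx ler01. Qed.

Lemma bounded_nonneg_char A : bounded_nonneg (char A).
Proof. by exists 1; apply: char01. Qed.

Lemma bounded_nonnegD f g : bounded_nonneg f -> bounded_nonneg g ->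
  bounded_nonneg (fun k => f k + g k).
Proof.
move=> [M fM] [N gN]; exists (M + N) => k.
by have /andP[? ?] := fM k; have /andP[? ?] := gN k; rewrite addr_ge0 ?lerD.
Qed.

Lemma positive_mono C v f g : is_positive C v ->
  bounded_nonneg f -> bounded_nonneg g -> (forall k, f k <= g k) -> v f <= v g.
Proof.
move=> [vD vb] bf bg fg; have [M gM] := bg.
have b k : 0 <= g k - f k <= M.
  have /andP[? ?] := gM k; have := fg k; have [? fM] := bf.
  by have /andP[? _] := fM k => ?; apply/andP; split; lra.
have -> : g = fun k => f k + (g k - f k).
  by apply/funext => k; rewrite addrCA subrr addr0.
by rewrite vD//; [have /andP[? _] := vb _ _ b; rewrite lerDl|exists M].
Qed.

Lemma positive_mulrn C v f n : is_positive C v -> bounded_nonneg f ->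
  v (fun k => f k *+ n) = v f *+ n.
Proof.
move=> [vD vb] [M fM]; have M0 : 0 <= M by have /andP[] := fM 0%N; apply: le_trans.
elim: n => [|n IH].
  have /vb/andP[] : forall k, 0 <= f k *+ 0 <= 0 by move=> k; rewrite mulr0n lexx.
  by rewrite mulr0 mulr0n => h1 h2; apply/eqP; rewrite eq_le h1 h2.
rewrite mulrS -IH -vD; first by congr v; apply/funext => k; rewrite mulrS.
  by exists M.
exists (M *+ n) => k; have /andP[? ?] := fM k.
by rewrite mulrn_wge0// lerMn2r; apply/orP; right.
Qed.

Lemma positive_content C v : is_positive C v -> is_content C (fun A => v (char A)).
Proof.
move=> vP; have [vD vb] := vP; split.
- by move=> A; have := vb _ _ (char01 A); rewrite mulr1.
- move=> A B D sub; rewrite -vD; try exact: bounded_nonneg_char.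
  apply: (positive_mono vP) => [||k].
  + exact: bounded_nonneg_char.
  + by apply: bounded_nonnegD; apply: bounded_nonneg_char.
  have /andP[B0 _] := char01 B k; have /andP[D0 _] := char01 D k.
  have [Ak|nA] := pselect (A k); last by rewrite (charF nA) addr_ge0.
  by rewrite (charT Ak); case: (sub _ Ak) => /charT->; rewrite ?lerDl ?lerDr.
- move=> A B D dis sub; rewrite -vD; try exact: bounded_nonneg_char.
  apply: (positive_mono vP) => [||k].
  + by apply: bounded_nonnegD; apply: bounded_nonneg_char.
  + exact: bounded_nonneg_char.
  have [Ak|nA] := pselect (A k).
    rewrite (charT Ak) (charF (dis k Ak)) addr0 charT//.
    by apply: sub; left.
  rewrite (charF nA) add0r; have [Bk|nB] := pselect (B k).
    by rewrite (charT Bk) charT//; apply: sub; right.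
  by rewrite (charF nB); have /andP[] := char01 D k.
Qed.

(** The functional is the sum of the [v n] with weights [1 / 2 ^ n]. *)
Lemma weighted_sum_positive C (v : nat -> (nat -> R) -> R) :
  (forall n, is_positive C (v n)) ->
  exists C' m, is_positive C' m /\
    forall n f, bounded_nonneg f -> v n f <= 2 ^+ n * m f.
Proof.
move=> vP.
pose u f n := v n f / 2 ^+ n.
pose m f := limn (series (u f)).
have p2 i : 0 < 2 ^+ i :> R by rewrite exprn_gt0.
have u0 f n : bounded_nonneg f -> 0 <= u f n.
  move=> [M fM]; have [_ /(_ _ _ fM)/andP[? _]] := vP n.
  by rewrite divr_ge0// ltW.
have inc f : bounded_nonneg f -> nondecreasing_seq (series (u f)).
  move=> bf; apply/nondecreasing_seqP => n.
  by rewrite /series /= big_nat_recr//= lerDl u0.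
have ub f M n : (forall k, 0 <= f k <= M) -> series (u f) n <= C * M * (2 - 2 / 2 ^+ n).
  move=> fM; rewrite /series /=; elim: n => [|n IH].
    by rewrite big_geq// expr0 divr1 subrr mulr0.
  rewrite big_nat_recr//=; have [_ /(_ _ _ fM)/andP[_ h]] := vP n.
  have : u f n <= C * M / 2 ^+ n by rewrite /u ler_pM2r ?invr_gt0.
  move: IH; set s := \sum_(_ <= _ < _) _.
  by rewrite exprS invfM mulrA divff ?pnatr_eq0// mul1r; set t := (2 ^+ n)^-1; lra.
have ub2 f M n : (forall k, 0 <= f k <= M) -> series (u f) n <= C * 2 * M.
  move=> fM; apply: le_trans (ub f M n fM) _.
  have [_ /(_ _ _ fM)/andP[h1 h2]] := vP 0%N.
  have CM : 0 <= C * M by lra.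
  have : 0 <= C * M * (2 ^+ n)^-1 by rewrite mulr_ge0// invr_ge0 ltW.
  by set t := (2 ^+ n)^-1; lra.
have cv f : bounded_nonneg f -> cvgn (series (u f)).
  move=> bf; apply: nondecreasing_is_cvgn; first exact: inc.
  by have [M fM] := bf; exists (C * 2 * M) => _ [n _ <-]; apply: ub2.
have le_m f n : bounded_nonneg f -> series (u f) n <= m f.
  by move=> bf; apply: nondecreasing_cvgn_le; [apply: inc|apply: cv].
exists (C * 2), m; split; [split|].
- move=> f g bf bg; rewrite /m -limD; [|exact: cv|exact: cv].
  congr (limn _); apply/funext => n /=.
  rewrite -[RHS]/(series (u f) n + series (u g) n) /series /= -big_split /=.
  apply: eq_bigr => i _.
  by have [vD _] := vP i; rewrite /u vD// mulrDl.
- move=> f M fM; have bf : bounded_nonneg f by exists M.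
  apply/andP; split; first by have := le_m f 0%N bf; rewrite /series /= big_geq.
  by apply: limr_le; [exact: cv|near=> n; exact: ub2].
- move=> n f bf; have := le_m f n.+1 bf.
  rewrite /series /= big_nat_recr//= => h.
  have : u f n <= m f.
    apply: le_trans h; rewrite lerDr; apply: sumr_ge0 => i _; exact: u0.
  by rewrite /u ler_pdivrMr// mulrC.
Unshelve. all: by end_near.
Qed.

(** Let [q h = m (h^2)] and let [sup P] be the limit of the infima of [q] on the
    decreasing convex sets [CC k].  Elements of [CC K] and [CC k] that almost
    reach these infima have a midpoint in [CC K], where [q] is at least
    [sup P - e / 8]; the parallelogram identity then makes their difference
    small. *)
Lemma mazur C m (CC : nat -> set (linf R)) M (e : R) : is_positive C m ->
  (forall i j, (i <= j)%N -> CC j `<=` CC i) ->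
  (forall i, CC i !=set0) ->
  (forall i h h', CC i h -> CC i h' -> CC i (2^-1 *: (h + h'))) ->
  (forall h k, CC 0%N h -> `|h k| <= M) -> 0 < e ->
  exists K h, CC K h /\ forall k, (K <= k)%N ->
    exists2 h', CC k h' & m (fun k => (h k - h' k) ^+ 2) <= e.
Proof.
move=> mP dC nC cC bC e0; have [mD mb] := mP.
pose q h := m (fun k => h k ^+ 2).
have bsq h : bounded_nonneg (fun k => h k ^+ 2).
  exists (`|h| ^+ 2) => k; rewrite sqr_ge0 -[h k ^+ 2]real_normK ?num_real//.
  by rewrite lerXn2r ?nnegrE// linf_norm_ub.
pose P := [set x | exists K, forall h, CC K h -> x <= q h].
have hP : has_sup P.
  split; first by exists 0, 0%N => h _; have [N /mb/andP[]] := bsq h.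
  exists (C * M ^+ 2) => x [K] KP; have [h Ch] := nC K.
  apply: le_trans (KP h Ch) _.
  have b k : 0 <= h k ^+ 2 <= M ^+ 2.
    rewrite sqr_ge0 -[h k ^+ 2]real_normK ?num_real//.
    have hM := bC h k (dC _ _ (leq0n K) _ Ch).
    by rewrite lerXn2r ?nnegrE//; apply: le_trans hM.
  by have /andP[] := mb _ _ b.
have e8 : 0 < e / 8 by rewrite divr_gt0.
have [x [K Kx] xs] := sup_adherent e8 hP.
have next k : exists2 h, CC k h & q h < sup P + e / 8.
  apply: contrapT => nk; have : P (sup P + e / 8).
    by exists k => h Ch; rewrite leNgt; apply/negP => qh; apply: nk; exists h.
  by move=> /(ub_le_sup hP.2); rewrite gerDl leNgt e8.
have [h Ch qh] := next K; exists K, h; split=> // k Kk.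
have [h' Ch' qh'] := next k; exists h' => //.
have /Kx : CC K (2^-1 *: (h + h')) by apply: cC => //; apply: dC Ch'.
set z := 2^-1 *: (h + h').
have bn (g : linf R) n : bounded_nonneg (fun k => g k ^+ 2 *+ n).
  have [N gN] := bsq g; exists (N *+ n) => i; have /andP[? ?] := gN i.
  by rewrite mulrn_wge0// lerMn2r; apply/orP; right.
have : m (fun k => (h k - h' k) ^+ 2) + q z *+ 4 = q h *+ 2 + q h' *+ 2.
  rewrite /q -!(positive_mulrn _ mP)// -!mD //; last exact: (bsq (h - h')).
  congr m; apply/funext => i.
  have -> : z i = 2^-1 * (h i + h' i) by [].
  by field.
by lra.
Qed.

End Positive.

(** * Total variation of the coordinates of an operator *)
Section Coordinates.
Context (R : realType).
Implicit Types h x : linf R.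

Lemma linfD h x k : (h + x) k = h k + x k. Proof. by []. Qed.
Lemma linfB h x k : (h - x) k = h k - x k. Proof. by []. Qed.
Lemma linfN h k : (- h) k = - h k. Proof. by []. Qed.
Lemma linfZ (a : R) h k : (a *: h) k = a * h k. Proof. by []. Qed.

End Coordinates.

Section Variation.
Context (R : realType) (L : {linear linf R -> linf R}) (C : R).
Hypothesis LC : forall x, `|L x| <= C * `|x|.
Implicit Types (f g : nat -> R) (h x : linf R).

Definition to_linf f : linf R := insubd 0 f.

Lemma to_linfE f M : (forall k, `|f k| <= M) -> to_linf f = f :> (nat -> R).
Proof. by move=> fM; apply: insubdK; apply/bounded_seqP; exists M. Qed.

Lemma linf_le h M : (forall k, `|h k| <= M) -> `|h| <= M.
Proof. exact: linf_norm_le. Qed.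

Lemma linf_ge h k : `|h k| <= `|h|.
Proof. exact: linf_norm_ub. Qed.

(** The value at [f] of the absolute value of the functional [h |-> (L h) n]. *)
Definition variation n f : R :=
  sup [set L h n | h in [set h : linf R | forall k, `|h k| <= f k]].

Let C0 : 0 <= C.
Proof.
pose one : linf R := to_linf (fun=> 1).
have oneE k : one k = 1.
  by rewrite (@to_linfE _ 1)// => _; rewrite normr1.
have : 0 <= C * `|one| by apply: le_trans (LC one).
rewrite pmulr_lge0//; apply: lt_le_trans (linf_ge one 0).
by rewrite oneE normr1.
Qed.

Lemma variation_ub f M n h : (forall k, 0 <= f k <= M) ->
  (forall k, `|h k| <= f k) -> L h n <= C * M.
Proof.
move=> fM hf; apply: le_trans (ler_norm _) _; apply: le_trans (linf_ge _ _) _.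
apply: le_trans (LC _) _; rewrite ler_wpM2l//; apply: linf_le => k.
by apply: le_trans (hf k) _; have /andP[] := fM k.
Qed.

Lemma variation_has_sup f n : bounded_nonneg f ->
  has_sup [set L h n | h in [set h : linf R | forall k, `|h k| <= f k]].
Proof.
move=> [M fM]; split.
  by exists (L 0 n), 0 => //= k; rewrite normr0; have /andP[] := fM k.
by exists (C * M) => _ [h hf <-]; apply: variation_ub hf.
Qed.

Lemma variation_ge f n h : bounded_nonneg f -> (forall k, `|h k| <= f k) ->
  `|L h n| <= variation n f.
Proof.
move=> bf hf; have [_ ub] := variation_has_sup n bf.
have le x : (forall k, `|x k| <= f k) -> L x n <= variation n f.
  by move=> xf; apply: ub_le_sup => //; exists x.
rewrite ler_norml lerNl le// andbT.
have -> : - L h n = L (- h) n by rewrite raddfN.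
by apply: le => k; rewrite linfN normrN.
Qed.

Lemma variation_le f n y : bounded_nonneg f ->
  (forall h, (forall k, `|h k| <= f k) -> L h n <= y) -> variation n f <= y.
Proof.
move=> bf hy; apply: ge_sup; first by have [] := variation_has_sup n bf.
by move=> _ [h hf <-]; apply: hy.
Qed.

(** For additivity, a sequence bounded by [f + g] is cut into its truncation [u]
    to the interval between [- f] and [f], and a remainder bounded by [g]. *)
Lemma variation_positive n : is_positive C (variation n).
Proof.
split=> [f g bf bg|f M fM]; last first.
  have bf : bounded_nonneg f by exists M.
  apply/andP; split.
    apply: le_trans (variation_ge n (h := 0) bf _) => //= k.
    by rewrite normr0; have /andP[] := fM k.
  by apply: variation_le => // h; apply: variation_ub.
have bD := bounded_nonnegD bf bg.
apply/eqP; rewrite eq_le; apply/andP; split.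
  apply: variation_le => // h hfg.
  pose u k := Num.max (- f k) (Num.min (h k) (f k)).
  have [M fM] := bf; have [N gN] := bg.
  have uf k : `|u k| <= f k.
    have /andP[f0 _] := fM k; rewrite ler_norml /u; apply/andP; split.
      by rewrite le_max lexx.
    by rewrite ge_max ge_min lexx orbT andbT; lra.
  have uE : to_linf u = u :> (nat -> R).
    by apply: (@to_linfE _ M) => k; apply: le_trans (uf k) _; have /andP[] := fM k.
  have -> : L h n = L (to_linf u) n + L (h - to_linf u) n.
    by rewrite raddfB linfB addrCA subrr addr0.
  apply: lerD; apply: le_trans (ler_norm _) _; apply: variation_ge => // k.
    by rewrite uE.
  rewrite linfB uE.
  have /andP[f0 _] := fM k; have /andP[g0 _] := gN k.
  have := hfg k; rewrite !ler_norml => /andP[h1 h2]; rewrite /u.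
  rewrite maxEle minEle; do 2 case: ifPn; rewrite -?ltNge; move=> *;
    by apply/andP; split; lra.
apply/ler_addgt0Pr => e e0; have e2 : 0 < e / 2 by rewrite divr_gt0.
have [_ [h hf <-] hs] := sup_adherent e2 (variation_has_sup n bf).
have [_ [x xg <-] xs] := sup_adherent e2 (variation_has_sup n bg).
have : L (h + x) n <= variation n (fun k => f k + g k).
  apply: le_trans (ler_norm _) _; apply: variation_ge => // k.
  rewrite linfD; apply: le_trans (ler_normD _ _) _.
  by apply: lerD; [apply: hf|apply: xg].
rewrite raddfD linfD -/(variation n f) -/(variation n g) in hs xs *.
by lra.
Qed.

End Variation.

(** * The obstruction to lifting *)
Lemma injective_unbounded (f : nat -> nat) N : injective f -> exists i, (N <= f i)%N.
Proof.
move=> f_inj; apply: contrapT => /forallNP nf.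
have fN i : (f i < N)%N by rewrite ltnNge; apply/negP/nf.
have gI : injective (fun i : 'I_N.+1 => Ordinal (fN i)).
  by move=> i j /(congr1 val) /= /f_inj /ord_inj.
by have := leq_card _ gI; rewrite !card_ord ltnn.
Qed.

Lemma no_injection_to_countable (T : countType) (f : (nat -> bool) -> T) :
  ~ injective f.
Proof.
move=> f_inj; have g_inj : injective (pickle \o f).
  by apply: inj_comp => //; apply: pcan_inj pickleK.
pose d k := ~~ `[< exists2 a, (pickle \o f) a = k & a k >].
have : d ((pickle \o f) d) = ~~ d ((pickle \o f) d).
  rewrite {1}/d; congr (~~ _); apply/asboolP/idP => [[a /g_inj->]//|dd].
  by exists d.
by case: (d _).
Qed.

Section Core.
Context (R : realType).

(** Otherwise every [a] is isolated at some precision [1 / (K a + 1)] by its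
    first [K a + 1] coordinates.  The number [K a] and the rounded
    coordinates then determine [a], but there are only countably many such
    data. *)
Lemma sequence_cluster (F : (nat -> bool) -> nat -> R) :
  exists a, forall K : nat, exists2 b, b <> a &
    forall n, (n <= K)%N -> `|F b n - F a n| <= K.+1%:R^-1.
Proof.
apply: contrapT => /forallNP nF.
have /choice[K KP] a : exists K : nat, forall b, b <> a ->
    exists2 n, (n <= K)%N & K.+1%:R^-1 < `|F b n - F a n|.
  have /existsNP[K nK] := nF a; exists K => b ba.
  apply: contrapT => nn; apply: nK; exists b => // n nK.
  by rewrite leNgt; apply/negP => lt; apply: nn; exists n.
pose code a := (K a, [seq Num.floor ((K a).+1%:R * F a n) | n <- iota 0 (K a).+1]).
apply: (@no_injection_to_countable _ code) => a b cab.
have Kab : K a = K b := congr1 fst cab.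
have := congr1 snd cab; rewrite /code [LHS]/snd [RHS]/snd => sab.
apply: contrapT => ab; have [|n nK] := KP a b; first by move=> E; apply: ab.
apply/negP; rewrite -leNgt; rewrite Kab in sab nK *.
have := congr1 (fun s => nth (0 : int) s n) sab.
rewrite !(nth_map 0%N) ?size_iota// !nth_iota// !add0n => fl.
set c : R := (K b).+1%:R in fl *.
have c0 : 0 < c by rewrite ltr0n.
have /andP[a1 a2] := floor_itv (c * F a n).
have /andP[b1 b2] := floor_itv (c * F b n).
rewrite fl in a1 a2; rewrite intrD in a2 b2.
rewrite -(ler_pM2l c0) mulfV ?gt_eqF//.
rewrite -{1}(gtr0_norm c0) -normrM mulrBr ler_norml; apply/andP; split; lra.
Qed.

Variables (L : {linear linf R -> linf R}) (C : R).
Hypothesis LC : forall x, `|L x| <= C * `|x|.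
Local Notation V := (variation L).

(** If not, the variation of the coordinate [nn i] on [D i] exceeds [e] for each
    [i].  Among infinitely many disjoint rows of indices, one has a union of tiny
    mass [lam], and Rosenthal's lemma makes the other sets negligible for
    the coordinate attached to a given one.  Gluing nearly extremal [g i]
    supported on the [D i] gives a sequence whose image is large at all
    coordinates [nn (c i)], which are distinct, against [small]. *)
Lemma variation_exhaustive (lam : (nat -> R) -> R) (Cl : R) :
  is_positive Cl lam ->
  (forall (f : linf R) (e : R), 0 < e -> lam (fun k => f k ^+ 2) <= e ^+ 2 ->
     exists N : nat, forall n, (N <= n)%N -> `|L f n| <= 2 * e) ->
  uniformly_exhaustive (fun n A => V n (char R A)).
Proof.
move=> lamP small D e dD e0; apply: contrapT => /forallNP nD.
have cV n : is_content C (fun A => V n (char R A)).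
  exact/positive_content/variation_positive.
have /choice[nn nnP] i : exists n, e < V n (char R (D i)).
  have /existsNP[n /negP] := nD i.
  by rewrite -ltNge => ?; exists n.
have c_inj p j p' j' : pickle (p, j) = pickle (p', j') ->
    p = p' :> nat /\ j = j' :> nat.
  by move=> /(pcan_inj (@pickleK _)) [].
have e8 : 0 < e / 8 by rewrite divr_gt0.
have dU : pairwise_disj (fun p : nat => [set k | exists j : nat, D (pickle (p, j)) k]).
  move=> p p' k [j Dj] [j' Dj'].
  by have /c_inj[] := dD _ _ _ Dj Dj'.
have [p pP] := content_small (positive_content lamP) dU (exprn_gt0 2 e8).
pose W := [set k | exists j : nat, D (pickle (p, j)) k].
have W01 := char01 R W.
have e4 : 0 < e / 4 by rewrite divr_gt0.
have dDp : pairwise_disj (fun j : nat => D (pickle (p, j))).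
  by move=> i j k Di Dj; have /c_inj[] := dD _ _ _ Di Dj.
have [s s_inj sP] := rosenthal (fun i => cV (nn (pickle (p, i)))) dDp e4.
pose c i := pickle (p, s i).
have cI : injective c by move=> i j /c_inj[_] /s_inj.
have {}sP i : V (nn (c i)) (char R [set k | exists2 j, j <> i & D (c j) k]) < e / 4.
  exact: sP.
have nI : injective (fun i => nn (c i)).
  move=> i j /= nij; apply: contrapT => ij.
  have := nnP (c j); have := sP i; rewrite nij.
  suff : V (nn (c j)) (char R (D (c j)))
      <= V (nn (c j)) (char R [set k | exists2 j0, j0 <> i & D (c j0) k]) by lra.
  apply: (content_mono (cV (nn (c j)))) => k Dk.
  by exists j => // ji; apply: ij.
have /choice[g gP] i : exists g : linf R,
    (forall k, `|g k| <= char R (D (c i)) k) /\ e < L g (nn (c i)).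
  apply: contrapT => /forallNP ng; have := nnP (c i); apply/negP; rewrite -leNgt.
  apply: (variation_le LC); first exact: bounded_nonneg_char.
  move=> h hD; rewrite leNgt; apply/negP => Lh; exact: (ng h).
pose u k :=
  if pselect (exists i, D (c i) k) is left ex then g (projT1 (cid ex)) k else 0.
have uE i k : D (c i) k -> u k = g i k.
  move=> Dk; rewrite /u; case: pselect => [ex|nex]; last by case: nex; exists i.
  case: (cid ex) => j /= Dj; have ji : j = i by apply: cI; apply: dD Dj Dk.
  by rewrite ji.
have u1 k : `|u k| <= char R W k.
  rewrite /u; case: pselect => [ex|nex].
    case: (cid ex) => j /= Dj; rewrite charT; last by exists (s j).
    by apply: le_trans ((gP j).1 k) _; rewrite charT.
  by rewrite normr0; have /andP[] := W01 k.
have hE : to_linf u = u :> (nat -> R).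
  apply: (@to_linfE _ _ 1) => k; apply: le_trans (u1 k) _.
  by have /andP[] := W01 k.
have [|N NP] := small (to_linf u) _ e8.
  apply: le_trans pP; apply: (positive_mono lamP).
  - exists 1 => k; rewrite hE sqr_ge0 -[u k ^+ 2]real_normK ?num_real//.
    rewrite expr_le1// ; apply: le_trans (u1 k) _.
    by have /andP[] := W01 k.
  - exact: bounded_nonneg_char.
  move=> k; rewrite hE -[u k ^+ 2]real_normK ?num_real// expr2.
  have := u1 k; have := W01 k.
  set t := char _ _ _ => /andP[t0 t1] ut.
  have : 0 <= `|u k| by []. nra.
have [i iN] := injective_unbounded N nI.
have := NP _ iN.
have [g1 g2] := gP i.
have -> : L (to_linf u) (nn (c i)) =
    L (g i) (nn (c i)) + L (to_linf u - g i) (nn (c i)).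
  by rewrite raddfB linfB addrCA subrr addr0.
have : `|L (to_linf u - g i) (nn (c i))| <= e / 4.
  apply: le_trans (ltW (sP i)); apply: (variation_ge LC).
    exact: bounded_nonneg_char.
  move=> k; rewrite linfB hE.
  have [Di|nDi] := pselect (D (c i) k).
    rewrite (uE i)// subrr normr0.
    by case/andP: (char01 R [set k | exists2 j, j <> i & D (c j) k] k).
  have -> : g i k = 0.
    apply/normr0_eq0/eqP; rewrite -normr_le0 normr_id.
    by apply: le_trans (g1 k) _; rewrite charF.
  rewrite subr0 /u; case: pselect => [ex|nex].
    case: (cid ex) => j /= Dj; rewrite charT.
      by apply: le_trans ((gP j).1 k) _; rewrite charT.
    by exists j => // ji; apply: nDi; rewrite -ji.
  by rewrite normr0; case/andP: (char01 R [set k | exists2 j, j <> i & D (c j) k] k).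
rewrite !ler_norml => /andP[h1 h2] /andP[h3 h4]; lra.
Qed.

(** Chebyshev: when [m (h^2)] is small, so is the [m]-mass of the set where [h]
    exceeds [1 / N], hence its variations.  The rest of [h] is uniformly
    small. *)
Lemma exhaustive_small m Cm M (e : R) :
  uniformly_exhaustive (fun n A => V n (char R A)) ->
  is_positive Cm m ->
  (forall n f, bounded_nonneg f -> V n f <= 2 ^+ n * m f) -> 0 < e ->
  exists2 d : R, 0 < d & forall h : linf R, (forall k, `|h k| <= M%:R) ->
    m (fun k => h k ^+ 2) <= d -> forall n, `|L h n| <= e.
Proof.
move=> exV mP Vm e0.
have cV n : is_content C (fun A => V n (char R A)).
  exact/positive_content/variation_positive.
have C0 : 0 <= C by have [/(_ set0)/andP[h1 h2] _ _] := cV 0%N; apply: le_trans h2.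
pose e1 := e / 2 / M.+1%:R.
have e1_gt0 : 0 < e1 by rewrite !divr_gt0.
(* uniform absolute continuity of the variations with respect to [m] *)
have [d d0 dP] : exists2 d : R, 0 < d & forall A, m (char R A) <= d ->
    forall n, V n (char R A) <= e1.
  apply: contrapT => nd.
  have /choice[E EP] i : exists A, m (char R A) <= (2 ^+ i)^-1 /\
      exists n, e1 < V n (char R A).
    apply: contrapT => /forallNP nA; apply: nd; exists (2 ^+ i)^-1.
      by rewrite invr_gt0 exprn_gt0.
    move=> A mA n; rewrite leNgt; apply/negP => Vn.
    by apply: (nA A); split=> //; exists n.
  have EK n i : V n (char R (E i)) <= 2 ^+ n / 2 ^+ i.
     apply: le_trans (Vm n _ (bounded_nonneg_char _ _)) _.
    by rewrite ler_pM2l ?exprn_gt0//; have [] := EP i.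
  have [i iP] := exhaustive_control cV exV EK e1_gt0.
  by have [_ [n]] := EP i; rewrite ltNge iP.
pose N := (Num.truncn (C / (e / 2))).+1.
have NC : C / N%:R <= e / 2.
  have e2 : 0 < e / 2 by rewrite divr_gt0.
  by rewrite ler_pdivrMr ?ltr0n// mulrC -ler_pdivrMr//; apply/ltW/truncnS_gt.
exists (d / (N ^ 2)%:R) => [|h hM mh n].
  by rewrite divr_gt0// ltr0n expn_gt0.
pose D := [set k | N%:R^-1 < `|h k|].
have bh : bounded_nonneg (fun k => h k ^+ 2).
  exists (M%:R ^+ 2) => k; rewrite sqr_ge0 -[h k ^+ 2]real_normK ?num_real//.
  by rewrite lerXn2r ?nnegrE.
have VD : V n (char R D) <= e1.
  apply: dP; apply: (@le_trans _ _ (m (fun k => h k ^+ 2 *+ (N ^ 2)))).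
    apply: (positive_mono mP); first exact: bounded_nonneg_char.
      have [Q hQ] := bh; exists (Q *+ (N ^ 2)) => k; have /andP[? ?] := hQ k.
      by rewrite mulrn_wge0// lerMn2r; apply/orP; right.
    move=> k; have [Dk|nD] := pselect (D k); last first.
      by rewrite charF// mulrn_wge0// sqr_ge0.
    rewrite charT// -mulr_natr natrX -exprMn -real_normK ?num_real// exprn_ege1//.
    have N0 : 0 < N%:R :> R by rewrite ltr0n.
    by rewrite normrM (gtr0_norm N0) -ler_pdivrMr// mul1r; exact: ltW.
  rewrite (positive_mulrn _ mP)// -mulr_natr -ler_pdivlMr ?ltr0n ?expn_gt0//.
have h1E : to_linf (fun k => h k * char R D k) =
    (fun k => h k * char R D k) :> (nat -> R).
  apply: (@to_linfE _ _ M%:R) => k; rewrite normrM; apply: le_trans (hM k).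
  by rewrite ler_piMr//; have /andP[? ?] := char01 R D k; rewrite ger0_norm.
set h1 := to_linf _ in h1E.
have -> : L h n = L h1 n + L (h - h1) n.
  by rewrite raddfB linfB addrCA subrr addr0.
apply: le_trans (ler_normD _ _) _; rewrite [e]splitr; apply: lerD.
  apply: (@le_trans _ _ (V n (fun k => char R D k *+ M.+1))).
    apply: (variation_ge LC).
      exists M.+1%:R => k; have /andP[? ?] := char01 R D k.
      by rewrite mulrn_wge0// lerMn2r; apply/orP; right.
    move=> k; rewrite h1E normrM mulrC -mulr_natr; have /andP[? ?] := char01 R D k.
    by rewrite ger0_norm// ler_wpM2l//; apply: le_trans (hM k) _; rewrite ler_nat.
  rewrite (positive_mulrn _ (variation_positive LC n)); last exact: bounded_nonneg_char.
  by rewrite -[_ *+ M.+1]mulr_natr -ler_pdivlMr.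
apply: le_trans (linf_ge _ _) _; apply: le_trans (LC _) _; apply: le_trans NC.
rewrite ler_wpM2l//; apply: linf_le => k; rewrite linfB h1E.
have [Dk|nD] := pselect (D k).
  by rewrite charT// mulr1 subrr normr0 invr_ge0.
by rewrite charF// mulr0 subr0 leNgt; apply/negP.
Qed.

(** The set [CC k] collects the properties of the differences [w b - w a] that
    are stable under averaging.  The bound [4] on the coordinates is that of a
    difference of two of its elements. *)
Lemma no_operator_separating_branches (lam : (nat -> R) -> R) (Cl : R)
    (w : (nat -> bool) -> linf R) (B : (nat -> bool) -> set nat) :
  is_positive Cl lam ->
  (forall (f : linf R) (e : R), 0 < e -> lam (fun k => f k ^+ 2) <= e ^+ 2 ->
     exists N : nat, forall n, (N <= n)%N -> `|L f n| <= 2 * e) ->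
  (forall a k, `|w a k| <= 1) ->
  (forall a N, exists2 n, (N <= n)%N & B a n) ->
  (forall a b (e : R), 0 < e -> exists N, forall n, (N <= n)%N -> B a n ->
     `|L (w b) n - (`[< a = b >])%:R| <= e) -> False.
Proof.
move=> lamP small w1 Binf Lw.
have exV := variation_exhaustive lamP small.
have [C' [m [mP Vm]]] := weighted_sum_positive (variation_positive LC).
have [a aP] := sequence_cluster (fun a => L (w a)).
pose CC (k : nat) := [set h : linf R | [/\ forall j, `|h j| <= 2,
   forall n, (n <= k)%N -> `|L h n| <= k.+1%:R^-1 &
   forall e : R, 0 < e ->
     exists N, forall n, (N <= n)%N -> B a n -> `|L h n + 1| <= e]].
have q4 : 0 < 4^-1 :> R by rewrite invr_gt0.
have [d d0 dP] := exhaustive_small 4 exV mP Vm q4.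
have dec i j : (i <= j)%N -> CC j `<=` CC i.
  move=> ij h [h2 hj hB]; split=> // n ni.
  apply: le_trans (hj n (leq_trans ni ij)) _.
  by rewrite lef_pV2 ?posrE ?ltr0n// ler_nat.
have ne i : CC i !=set0.
  have [b ba bP] := aP i; exists (w b - w a); split.
  + move=> j; rewrite linfB; apply: le_trans (ler_normB _ _) _.
    by have := w1 a j; have := w1 b j; lra.
  + by move=> n ni; rewrite raddfB linfB; apply: bP.
  + move=> e e0; have e2 : 0 < e / 2 by rewrite divr_gt0.
    have [N1 N1P] := Lw a b _ e2; have [N2 N2P] := Lw a a _ e2.
    exists (maxn N1 N2) => n; rewrite geq_max => /andP[/N1P h1 /N2P h2] Bn.
    have := h1 Bn; have := h2 Bn; rewrite raddfB linfB.
    rewrite (asboolT erefl) asboolF; last by move=> E; apply: ba.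
    rewrite mulr1n mulr0n.
    by rewrite !ler_norml => /andP[? ?] /andP[? ?]; apply/andP; split; lra.
have mid i h h' : CC i h -> CC i h' -> CC i (2^-1 *: (h + h')).
  move=> [h2 hj hB] [h2' hj' hB'].
  have avg (c x y z : R) : `|x + z| <= c -> `|y + z| <= c -> `|2^-1 * (x + y) + z| <= c.
    by rewrite !ler_norml => /andP[? ?] /andP[? ?]; apply/andP; split; lra.
  split.
  + move=> j; rewrite linfZ linfD -[_ * _]addr0.
    by apply: avg; rewrite addr0; [exact: h2|exact: h2'].
  + move=> n ni; rewrite linearZ linfZ raddfD linfD -[_ * _]addr0.
    by apply: avg; rewrite addr0; [exact: hj|exact: hj'].
  + move=> e e0; have [N1 N1P] := hB _ e0; have [N2 N2P] := hB' _ e0.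
    exists (maxn N1 N2) => n; rewrite geq_max => /andP[/N1P h1 /N2P h3] Bn.
    by rewrite linearZ linfZ raddfD linfD; apply: avg; [apply: h1|apply: h3].
have bd h k : CC 0%N h -> `|h k| <= 2 by case.
have [K [h [[h2 hK hB] hP]]] := mazur mP dec ne mid bd d0.
have Lh n : `|L h n| <= 1 / 2.
  pose k := maxn K (maxn n 3).
  have [h' [h2' hk' _] qd] := hP k (leq_maxl _ _).
  have -> : L h n = L (h - h') n + L h' n by rewrite raddfB linfB subrK.
  apply: le_trans (ler_normD _ _) _.
  have -> : 1 / 2 = 4^-1 + 4^-1 :> R by field.
  apply: lerD.
    apply: dP => // j; rewrite linfB; apply: le_trans (ler_normB _ _) _.
    by have := h2 j; have := h2' j; lra.
  apply: le_trans (hk' n _) _; first by rewrite /k !leq_max leqnn orbT.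
  by rewrite lef_pV2 ?posrE ?ltr0n// ler_nat ltnS /k !leq_max leqnn !orbT.
have [N NP] := hB _ q4; have [n nN Bn] := Binf a N.
by have := NP n nN Bn; have := Lh n; rewrite !ler_norml => /andP[? ?] /andP[? ?]; lra.
Qed.

End Core.

(** * Walsh functions and their mean *)
Section Walsh.
Context (R : realType).
Implicit Types (F G : seq bool -> R).

(** The mean of [F] over the [2 ^ n] strings of length [n]. *)
Fixpoint average n F : R :=
  if n is n'.+1 then
    (average n' (fun s => F (true :: s)) + average n' (fun s => F (false :: s))) / 2
  else F [::].

Lemma average_linear n c F G :
  average n (fun s => c * F s + G s) = c * average n F + average n G.
Proof. by elim: n F G => [//|n IH] F G /=; rewrite !IH; field. Qed.

Lemma eq_average n F G : F =1 G -> average n F = average n G.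
Proof. by move=> /funext ->. Qed.

Lemma average_le n F G : (forall s, size s = n -> F s <= G s) ->
  average n F <= average n G.
Proof.
elim: n F G => [|n IH] F G FG /=; first exact: FG.
rewrite ler_pM2r ?invr_gt0//; apply: lerD; apply: IH => s sn; apply: FG;
  by rewrite /= sn.
Qed.

Lemma average_cst n c : average n (fun=> c) = c.
Proof. by elim: n => [//|n /= ->]; field. Qed.

Lemma average_norm n F M : (forall s, size s = n -> `|F s| <= M) ->
  `|average n F| <= M.
Proof.
move=> FM; rewrite ler_norml -{1}(average_cst n (- M)) -{2}(average_cst n M).
by apply/andP; split; apply: average_le => s /FM; rewrite ler_norml => /andP[].
Qed.

Fixpoint walsh (a : nat -> bool) (s : seq bool) : R :=
  if s is b :: s' then (-1) ^+ (b && a 0%N) * walsh (a \o S) s' else 1.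

Lemma walsh_norm a s : `|walsh a s| = 1.
Proof.
elim: s a => [|b s IH] a /=; first by rewrite normr1.
by rewrite normrM normrX normrN1 expr1n IH mulr1.
Qed.

Lemma average_walsh_eq n a : average n (fun s => walsh a s * walsh a s) = 1.
Proof.
rewrite -[RHS](average_cst n); apply: eq_average => s.
by rewrite -expr2 -real_normK ?num_real// walsh_norm expr1n.
Qed.

(** At a position where [a] and [b] differ, flipping the letter of the string
    changes the sign of the product. *)
Lemma average_walsh_neq n i a b : (i < n)%N -> a i <> b i ->
  average n (fun s => walsh a s * walsh b s) = 0.
Proof.
elim: n i a b => [//|n IH] i a b i_n ab /=.
have E (d e : R) : average n (fun s => d * walsh (a \o S) s * (e * walsh (b \o S) s)) =
    d * e * average n (fun s => walsh (a \o S) s * walsh (b \o S) s).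
  rewrite -[RHS]addr0 -[X in _ + X](average_cst n) -average_linear.
  by apply: eq_average => s; ring.
rewrite !E; case: i i_n ab => [_|i i_n] ab; last by rewrite (IH i)// !mulr0 addr0 mul0r.
rewrite -mulrDl; case: (a 0%N) (b 0%N) ab => [] [] //= _;
  by rewrite ?expr0 ?expr1 ?mulr1 ?mul1r ?subrr ?addNr ?addrN ?mul0r.
Qed.

End Walsh.

Section Mean.
Context (R : realType) (U : set_system nat) (UU : UltraFilter U)
  (Uoo : (\oo : set_system nat) `<=` U).
Implicit Types (f g : nat -> R).

Lemma ultrafilter_limit (u : nat -> R) M : (forall n, `|u n| <= M) -> cvg (u @ U).
Proof.
move=> uM; have PU : ProperFilter U by exact: ultra_proper.
have K := @segment_compact R (- M) M.
have [|p [_ cp]] := K (u @ U) _.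
  change (U (u @^-1` `[- M, M]%classic)); apply: filterS filterT => n _ /=.
  by rewrite in_itv /= -ler_norml; exact: uM.
apply: (cvgP p) => V nV /=.
have [//|UnV] := in_ultra_setVsetC (u @^-1` V) UU.
by have [x [nx Vx]] := cp (~` V) V UnV nV.
Qed.

Definition is_bounded f := exists M, forall k, `|f k| <= M.

(** The tag [true] marks the first of the two copies of the binary strings. *)
Definition at_level (f : nat -> R) n := average n (fun s => f (pickle (true, s))).

Definition mean f : R := lim (at_level f @ U).

Lemma mean_cvg f : is_bounded f -> at_level f @ U --> mean f.
Proof.
move=> [M fM]; apply: (@ultrafilter_limit _ M) => n; exact: average_norm.
Qed.

Lemma meanE f l : is_bounded f -> at_level f @ U --> l -> mean f = l.
Proof.
move=> bf fl; have PU : ProperFilter U by exact: ultra_proper.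
by apply: cvg_unique fl; [exact: norm_hausdorff|exact: mean_cvg].
Qed.

Lemma is_boundedD f g : is_bounded f -> is_bounded g ->
  is_bounded (fun k => f k + g k).
Proof.
move=> [M fM] [N gN]; exists (M + N) => k.
by apply: le_trans (ler_normD _ _) _; apply: lerD.
Qed.

Lemma is_boundedM f g : is_bounded f -> is_bounded g ->
  is_bounded (fun k => f k * g k).
Proof.
move=> [M fM] [N gN]; exists (M * N) => k.
by rewrite normrM; apply: ler_pM.
Qed.

Lemma is_bounded_cst c : is_bounded (fun=> c).
Proof. by exists `|c|. Qed.

Lemma mean_linear c f g : is_bounded f -> is_bounded g ->
  mean (fun k => c * f k + g k) = c * mean f + mean g.
Proof.
move=> bf bg; have PU : ProperFilter U by exact: ultra_proper.
apply: meanE.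
  by apply: is_boundedD => //; apply: is_boundedM => //; exact: is_bounded_cst.
have -> : at_level (fun k => c * f k + g k) = fun n => c * at_level f n + at_level g n.
  by apply/funext => n; rewrite /at_level average_linear.
apply: cvgD; last exact: mean_cvg.
by apply: cvgM; [exact: cvg_cst|exact: mean_cvg].
Qed.

Lemma mean_le f g : is_bounded f -> is_bounded g -> (forall k, f k <= g k) ->
  mean f <= mean g.
Proof.
move=> bf bg fg; have PU : ProperFilter U by exact: ultra_proper.
apply: ler_lim; [exact: mean_cvg|exact: mean_cvg|].
by apply: filterS filterT => n _; exact: average_le.
Qed.

Lemma mean_cst c : mean (fun=> c) = c.
Proof.
have PU : ProperFilter U by exact: ultra_proper.
apply: meanE; first exact: is_bounded_cst.
rewrite /at_level; under eq_fun do rewrite average_cst; exact: cvg_cst.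
Qed.

Lemma mean_positive : is_positive 1 mean.
Proof.
split=> [f g [M fM] [N gN]|f M fM].
  have bf : is_bounded f.
    by exists M => k; have /andP[? ?] := fM k; rewrite ger0_norm.
  have bg : is_bounded g.
    by exists N => k; have /andP[? ?] := gN k; rewrite ger0_norm.
  rewrite -[mean f]mul1r -mean_linear//; congr mean.
  by apply/funext => k; rewrite mul1r.
have bf : is_bounded f.
  by exists M => k; have /andP[? ?] := fM k; rewrite ger0_norm.
rewrite mul1r; apply/andP; split.
  rewrite -(mean_cst 0); apply: mean_le => //; first exact: is_bounded_cst.
  by move=> k; have /andP[] := fM k.
rewrite -[X in _ <= X]mean_cst; apply: mean_le => //; first exact: is_bounded_cst.
by move=> k; have /andP[] := fM k.
Qed.

(** Only finitely many strings have a code below a given bound, so the strings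
    of length [n] are eventually all coded beyond it. *)
Lemma mean_vanish f : is_bounded f -> f n @[n --> \oo] --> (0 : R) -> mean f = 0.
Proof.
move=> bf f0; have PU : ProperFilter U by exact: ultra_proper.
apply: meanE => //; apply: cvg_trans (_ : at_level f @ \oo --> 0).
  by move=> A /= h; apply: Uoo.
apply/cvgr0Pnorm_le => e e0.
have [N _ NP] : \forall k \near \oo, `|f k| <= e.
  by move: f0 => /cvgr0Pnorm_le/(_ _ e0).
pose sz k :=
  if (unpickle k : option (bool * seq bool)) is Some (_, s) then size s else 0%N.
exists (\max_(k < N) sz k).+1 => // n /= nN.
apply: average_norm => s sn; apply: NP => /=; rewrite leqNgt; apply/negP => sN.
have := @leq_bigmax _ (fun k : 'I_N => sz k) (Ordinal sN).
by rewrite /= /sz pickleK sn leqNgt nN.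
Qed.

Definition walsh_seq (a : nat -> bool) (k : nat) : R :=
  if (unpickle k : option (bool * seq bool)) is Some (true, s) then walsh R a s else 0.

Lemma walsh_seq_le1 a k : `|walsh_seq a k| <= 1.
Proof.
rewrite /walsh_seq; case: unpickle => [[[] s]|]; rewrite ?normr0//.
by rewrite walsh_norm.
Qed.

Lemma walsh_seq_bounded a : is_bounded (walsh_seq a).
Proof. by exists 1; exact: walsh_seq_le1. Qed.

Lemma mean_walsh a b :
  mean (fun k => walsh_seq a k * walsh_seq b k) = (`[< a = b >])%:R.
Proof.
have PU : ProperFilter U by exact: ultra_proper.
apply: meanE; first by apply: is_boundedM; apply: walsh_seq_bounded.
have E n : at_level (fun k => walsh_seq a k * walsh_seq b k) n =
    average n (fun s => walsh R a s * walsh R b s).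
  by apply: eq_average => s; rewrite /walsh_seq pickleK.
case: asboolP => [ab|ab] /=.
  apply: cvg_near_cst; apply: filterS filterT => n _.
  by rewrite E ab average_walsh_eq.
have [i abi] : exists i, a i <> b i.
  by apply: contrapT => /forallNP nab; apply: ab; apply/funext => i; apply: contrapT.
apply: cvg_near_cst; apply: Uoo; exists i.+1 => // n /= i_n.
by rewrite E (average_walsh_neq R i_n abi).
Qed.

Definition coefficient f a : R := mean (fun k => f k * walsh_seq a k).

(** Bessel's inequality in the form of a count.  Subtracting from [f] its
    component along [w_a] lowers [mean (f^2)] by the square of the coefficient
    and leaves the other coefficients unchanged. *)
Lemma bessel f (s : seq (nat -> bool)) (e : R) : 0 <= e -> is_bounded f -> uniq s ->
  (forall a, a \in s -> e <= `|coefficient f a|) ->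
  (size s)%:R * e ^+ 2 <= mean (fun k => f k ^+ 2).
Proof.
move=> e0; elim: s f => [|a s IH] f bf /=.
  move=> _ _; rewrite mul0r -(mean_cst 0); apply: mean_le => [||k].
  - exact: is_bounded_cst.
  - exact: is_boundedM.
  - exact: sqr_ge0.
move=> /andP[a_s us] big.
set c := coefficient f a.
pose g k := - c * walsh_seq a k + f k.
have bw := walsh_seq_bounded.
have bcw b c' : is_bounded (fun k => c' * walsh_seq b k).
  by apply: is_boundedM => //; exact: is_bounded_cst.
have bg : is_bounded g by exact: is_boundedD.
have gE b : coefficient g b = - c * (`[< a = b >])%:R + coefficient f b.
  rewrite -mean_walsh -mean_linear; [|exact: is_boundedM|exact: is_boundedM].
  by congr mean; apply/funext => k; rewrite /g; ring.
have g2 : mean (fun k => g k ^+ 2) = mean (fun k => f k ^+ 2) - c ^+ 2.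
  have -> : mean (fun k => g k ^+ 2) =
      - c * coefficient g a + mean (fun k => g k * f k).
    rewrite -mean_linear; [|exact: is_boundedM|exact: is_boundedM].
    by congr mean; apply/funext => k; rewrite /g; ring.
  rewrite gE (asboolT erefl) mulr1 addNr mulr0 add0r.
  have -> : mean (fun k => g k * f k) = - c * c + mean (fun k => f k * f k).
    rewrite -mean_linear; [|exact: is_boundedM|exact: is_boundedM].
    by congr mean; apply/funext => k; rewrite /g; ring.
  by rewrite addrC mulNr -expr2; congr (_ - _).
have := IH g bg us _.
rewrite g2 -natr1 => H.
have : (size s)%:R * e ^+ 2 <= mean (fun k => f k ^+ 2) - c ^+ 2.
  apply: H => b bs; rewrite gE asboolF ?mulr0 ?add0r; last first.
    by move=> ab; move: a_s; rewrite ab bs.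
  by apply: big; rewrite inE bs orbT.
have : e ^+ 2 <= c ^+ 2.
  rewrite -[c ^+ 2]real_normK ?num_real// lerXn2r ?nnegrE//.
  by apply: big; rewrite inE eqxx.
lra.
Qed.

Lemma coefficient_le f (e : R) a : 0 <= e -> is_bounded f ->
  mean (fun k => f k ^+ 2) <= e ^+ 2 -> `|coefficient f a| <= e.
Proof.
move=> e0 bf fe; have := @bessel f [:: a] `|coefficient f a| (normr_ge0 _) bf isT.
rewrite mul1r => H; rewrite -(@ler_pXn2r _ 2) ?nnegrE//; apply: le_trans fe; apply: H.
by move=> b; rewrite inE => /eqP->.
Qed.

Lemma coefficient_c0 f (e : R) : 0 < e -> is_bounded f ->
  exists s : seq (nat -> bool), forall a, a \notin s -> `|coefficient f a| <= e.
Proof.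
move=> e0 bf; apply: contrapT => /forallNP ns.
have grow n : exists s, [/\ uniq s, size s = n &
    forall a, a \in s -> e <= `|coefficient f a|].
  elim: n => [|n [s [us sn sP]]]; first by exists [::].
  have /existsNP[a /not_implyP[a_s /negP]] := ns s; rewrite -ltNge => ae.
  exists (a :: s); split; rewrite /= ?a_s ?sn// => b.
  by rewrite inE => /orP[/eqP->|/sP//]; exact: ltW.
pose n := (Num.truncn (mean (fun k => f k ^+ 2) / e ^+ 2)).+1.
have [s [us sn sP]] := grow n.
have := bessel (ltW e0) bf us sP; rewrite sn -ler_pdivlMr ?exprn_gt0// leNgt.
by rewrite truncnS_gt.
Qed.

Lemma coefficient_linear c f g a : is_bounded f -> is_bounded g ->
  coefficient (fun k => c * f k + g k) a = c * coefficient f a + coefficient g a.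
Proof.
move=> bf bg; have bw := walsh_seq_bounded a.
rewrite -mean_linear; [|exact: is_boundedM|exact: is_boundedM].
by congr mean; apply/funext => k; ring.
Qed.

Lemma coefficient_bound f M a : (forall k, `|f k| <= M) -> `|coefficient f a| <= M.
Proof.
move=> fM; have bf : is_bounded f by exists M.
have M0 : 0 <= M by apply: le_trans (fM 0%N).
apply: coefficient_le => //; rewrite -(mean_cst (M ^+ 2)).
apply: mean_le => [||k]; [exact: is_boundedM|exact: is_bounded_cst|].
by rewrite -real_normK ?num_real// lerXn2r ?nnegrE.
Qed.

Lemma coefficient_vanish f a : is_bounded f -> f n @[n --> \oo] --> (0 : R) ->
  coefficient f a = 0.
Proof.
move=> bf f0; have bw := walsh_seq_bounded a.
apply: mean_vanish; first exact: is_boundedM.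
apply/cvgr0Pnorm_le => e e0; move: f0 => /cvgr0Pnorm_le/(_ _ e0).
apply: filterS => k; apply: le_trans; rewrite normrM ler_piMr//.
exact: walsh_seq_le1.
Qed.

End Mean.

(** * Families indexed by branches, modulo null sequences *)
Section Branches.
Implicit Types a b : nat -> bool.

(** The tag [false] keeps the branches away from the support of the mean. *)
Definition branch a : set nat := [set k | exists n, k = pickle (false, mkseq a n)].

Lemma branch_infinite a N : exists2 n, (N <= n)%N & branch a n.
Proof.
have inj : injective (fun n => pickle (false, mkseq a n)).
  move=> m n /(pcan_inj (@pickleK _)) [] /(congr1 size).
  by rewrite !size_mkseq.
have [i iN] := injective_unbounded N inj.
by exists (pickle (false, mkseq a i)) => //; exists i.
Qed.

Lemma branch_disjoint a b : a <> b ->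
  exists N, forall k, (N <= k)%N -> branch a k -> branch b k -> False.
Proof.
move=> ab; have [i abi] : exists i, a i <> b i.
  by apply: contrapT => /forallNP nab; apply: ab; apply/funext => i; apply: contrapT.
exists (\max_(n < i.+1) pickle (false, mkseq a n)).+1 => k kN [n kn] [m km].
have nm : mkseq a n = mkseq b m.
  by move: km; rewrite kn => /(pcan_inj (@pickleK _)) [].
have mn : m = n by have := congr1 size nm; rewrite !size_mkseq.
have [ni|i_n] := ltnP n i.+1.
  have := @leq_bigmax _ (fun n : 'I_i.+1 => pickle (false, mkseq a n)) (Ordinal ni).
  by rewrite /= -kn leqNgt kN.
by apply: abi; have := congr1 (fun s => nth false s i) nm; rewrite mn !nth_mkseq.
Qed.

Lemma branches_separated (s : seq (nat -> bool)) :
  exists N, forall k, (N <= k)%N -> forall a b, a \in s -> b \in s ->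
    branch a k -> branch b k -> a = b.
Proof.
have one a : exists N, forall k, (N <= k)%N -> forall b, b \in s ->
    branch a k -> branch b k -> a = b.
  elim: s => [|c s [N NP]]; first by exists 0%N.
  have [ac|ac] := pselect (a = c).
    by exists N => k kN b; rewrite inE => /orP[/eqP->//|]; exact: NP.
  have [N' N'P] := branch_disjoint ac.
  exists (maxn N N') => k; rewrite geq_max => /andP[kN kN'] b.
  rewrite inE => /orP[/eqP->|]; last exact: NP.
  by move=> ha hc; case: (N'P _ kN' ha hc).
suff gen (t : seq (nat -> bool)) : exists N, forall k, (N <= k)%N ->
    forall a b, a \in t -> b \in s ->
    branch a k -> branch b k -> a = b by exact: gen.
elim: t => [|c t [N NP]]; first by exists 0%N.
have [N' N'P] := one c.
exists (maxn N N') => k; rewrite geq_max => /andP[kN kN'] a b.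
by rewrite inE => /orP[/eqP->|at_] bs; [apply: N'P|apply: NP].
Qed.

End Branches.

Section Spread.
Context (R : realType).
Implicit Types (phi psi : (nat -> bool) -> R).

(** The value is [0] when no branch passes through [k]. *)
Definition upper phi (k : nat) : R :=
  sup (range (fun a => if `[< branch a k >] then Num.max (phi a) 0 else 0)).

(** A representative of the sum of [phi a] times the indicator of [branch a].
    When only one of the branches through [k] carries a large value, taking the
    extreme values on them recovers that value up to a small error. *)
Definition spread phi k := upper phi k - upper (fun a => - phi a) k.

Lemma upper_le phi k c : 0 <= c -> (forall a, branch a k -> phi a <= c) ->
  upper phi k <= c.
Proof.
move=> c0 le; apply: ge_sup; first by eexists; exists xpredT.
by move=> _ [a _ <-]; case: asboolP => // ak; rewrite ge_max c0 le.
Qed.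

Lemma upper_has_sup phi k M : (forall a, phi a <= M) ->
  has_sup (range (fun a => if `[< branch a k >] then Num.max (phi a) 0 else 0)).
Proof.
move=> pM; split; first by eexists; exists xpredT.
exists (Num.max M 0) => _ [a _ <-]; case: asboolP => _.
  by rewrite ge_max !le_max pM lexx orbT.
by rewrite le_max lexx orbT.
Qed.

Lemma upper_ge0 phi k M : (forall a, phi a <= M) -> 0 <= upper phi k.
Proof.
move=> pM; pose F a := if `[< branch a k >] then Num.max (phi a) 0 else 0.
apply: (@le_trans _ _ (F xpredT)).
  by rewrite /F; case: ifP => // _; rewrite le_max lexx orbT.
by apply: (ub_le_sup (upper_has_sup k pM).2); exists xpredT.
Qed.

Lemma upper_ge phi k M a : (forall a, phi a <= M) -> branch a k -> phi a <= upper phi k.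
Proof.
move=> pM ak; apply: (@le_trans _ _ (Num.max (phi a) 0)); first by rewrite le_max lexx.
apply: (ub_le_sup (upper_has_sup k pM).2); exists a => //.
by rewrite asboolT.
Qed.

Lemma spread_le phi k c M : (forall a, `|phi a| <= M) -> 0 <= c ->
  (forall a, branch a k -> `|phi a| <= c) -> `|spread phi k| <= c.
Proof.
move=> pM c0 le.
have h1 : upper phi k <= c by apply: upper_le => // a /le; exact/le_trans/ler_norm.
have h2 : upper (fun a => - phi a) k <= c.
  by apply: upper_le => // a /le; apply: le_trans; rewrite -normrN ler_norm.
have h3 : 0 <= upper phi k.
  by apply: (@upper_ge0 _ _ M) => a; apply: le_trans (pM a); exact: ler_norm.
have h4 : 0 <= upper (fun a => - phi a) k.
  by apply: (@upper_ge0 _ _ M) => a; apply: le_trans (pM a); rewrite -normrN ler_norm.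
by rewrite ler_norml /spread; apply/andP; split; lra.
Qed.

Lemma spread_near phi k c M a : (forall a, `|phi a| <= M) -> 0 <= c -> branch a k ->
  (forall b, branch b k -> b <> a -> `|phi b| <= c) -> `|spread phi k - phi a| <= c.
Proof.
move=> pM c0 ak le.
have pM1 b : phi b <= M by apply: le_trans (pM b); exact: ler_norm.
have pM2 b : - phi b <= M by apply: le_trans (pM b); rewrite -normrN ler_norm.
have h1 : upper phi k <= Num.max c (phi a).
  apply: upper_le => [|b bk]; first by rewrite le_max c0.
  have [->|ba] := pselect (b = a); first by rewrite le_max lexx orbT.
  by rewrite le_max; apply/orP; left; apply: le_trans (le b bk ba); exact: ler_norm.
have h2 : upper (fun a => - phi a) k <= Num.max c (- phi a).
  apply: upper_le => [|b bk]; first by rewrite le_max c0.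
  have [->|ba] := pselect (b = a); first by rewrite le_max lexx orbT.
  rewrite le_max; apply/orP; left; apply: le_trans (le b bk ba).
  by rewrite -normrN ler_norm.
have h3 := upper_ge0 k pM1; have h4 := upper_ge0 k pM2.
have h5 := upper_ge pM1 ak; have h6 := upper_ge pM2 ak; rewrite /= in h6.
move: h1 h2; rewrite ler_norml /spread !maxEle.
by do 2 case: ifPn; rewrite -?ltNge => *; apply/andP; split; lra.
Qed.

Definition is_c0_family phi := (exists M, forall a, `|phi a| <= M) /\
  forall e : R, 0 < e ->
    exists s : seq (nat -> bool), forall a, a \notin s -> `|phi a| <= e.

(** Outside a finite set of indices the three families are small, and far enough
    at most one branch from this finite set passes through [k].  At such a [k]
    each of the three spreads is close to the value of its family on that
    branch, or to [0] if there is none, and these values are linear. *)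
Lemma spread_linear c phi psi : is_c0_family phi -> is_c0_family psi ->
  is_c0_family (fun a => c * phi a + psi a) -> forall e, 0 < e ->
  exists N : nat, forall k, (N <= k)%N ->
    `|spread (fun a => c * phi a + psi a) k - (c * spread phi k + spread psi k)| <= e.
Proof.
move=> [[M1 b1] p1] [[M2 b2] p2] [[M3 b3] p3] e e0.
pose d := e / (`|c| + 2).
have c2 : 0 < `|c| + 2 by rewrite ltr_wpDl.
have d0 : 0 < d by rewrite divr_gt0.
have [s1 P1] := p1 d d0; have [s2 P2] := p2 d d0; have [s3 P3] := p3 d d0.
have [N NP] := branches_separated (s1 ++ s2 ++ s3).
have E : e = d + (`|c| * d + d) by rewrite /d; field; exact: lt0r_neq0.
exists N => k kN.
have fin (x y z t1 t2 : R) :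
    `|x - (c * t1 + t2)| <= d -> `|y - t1| <= d -> `|z - t2| <= d ->
    `|x - (c * y + z)| <= e.
  move=> hx hy hz.
  have -> : x - (c * y + z) = (x - (c * t1 + t2)) + (c * (t1 - y) + (t2 - z)) by ring.
  rewrite E; apply: le_trans (ler_normD _ _) _; apply: lerD => //.
  apply: le_trans (ler_normD _ _) _; apply: lerD; last by rewrite distrC.
  by rewrite normrM ler_wpM2l// distrC.
have [[a [as_ ak]]|nos] := pselect (exists a, a \in s1 ++ s2 ++ s3 /\ branch a k).
  have out b : branch b k -> b <> a -> b \notin s1 ++ s2 ++ s3.
    by move=> bk ba; apply/negP => bs; apply: ba; exact: (NP k kN).
  apply: (fin _ _ _ (phi a) (psi a)).
  - apply: (spread_near b3 (ltW d0) ak) => b bk /(out b bk).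
    by rewrite !mem_cat !negb_or => /and3P[_ _]; exact: P3.
  - apply: (spread_near b1 (ltW d0) ak) => b bk /(out b bk).
    by rewrite !mem_cat !negb_or => /and3P[+ _ _]; exact: P1.
  - apply: (spread_near b2 (ltW d0) ak) => b bk /(out b bk).
    by rewrite !mem_cat !negb_or => /and3P[_ + _]; exact: P2.
have out b : branch b k -> b \notin s1 ++ s2 ++ s3.
  by move=> bk; apply/negP => bs; apply: nos; exists b.
apply: (fin _ _ _ 0 0); rewrite ?mulr0 ?addr0 subr0.
- apply: (spread_le b3 (ltW d0)) => b /out.
  by rewrite !mem_cat !negb_or => /and3P[_ _]; exact: P3.
- apply: (spread_le b1 (ltW d0)) => b /out.
  by rewrite !mem_cat !negb_or => /and3P[+ _ _]; exact: P1.
- apply: (spread_le b2 (ltW d0)) => b /out.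
  by rewrite !mem_cat !negb_or => /and3P[_ + _]; exact: P2.
Qed.

Lemma spread_delta a k : spread (fun b => (`[< b = a >])%:R) k = char R (branch a) k.
Proof.
have b1 b : `|(`[< b = a >])%:R| <= 1 :> R.
  by case: asboolP => _; rewrite ?normr1 ?normr0.
have [ak|ak] := pselect (branch a k).
  have := spread_near b1 (lexx 0) ak; rewrite (asboolT erefl) charT// => H.
  apply/eqP; rewrite -subr_eq0 -normr_le0; apply: H => b _ ba.
  by rewrite asboolF// normr0.
rewrite charF//; apply/normr0_eq0/eqP; rewrite -normr_le0 normr_id.
apply: (spread_le b1 (lexx 0)) => b bk; rewrite asboolF ?normr0// => ba.
by apply: ak; rewrite -ba.
Qed.

End Spread.

(** * The operator and its lifts *)
Section Operator.
Context (R : realType) (U : set_system nat) (UU : UltraFilter U)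
  (Uoo : (\oo : set_system nat) `<=` U).
Implicit Types (f g : linf R).

Lemma linf_is_bounded f : is_bounded f.
Proof. by exists `|f|; exact: linf_ge. Qed.
Hint Resolve linf_is_bounded : core.

Local Notation coef f := (coefficient U f).

Lemma coef_c0_family f : is_c0_family (coef f).
Proof.
split; first by exists `|f| => a; apply: coefficient_bound => // k; exact: linf_ge.
by move=> e e0; exact: coefficient_c0.
Qed.

Lemma spread_coef_le f (c : R) k : (forall a, `|coef f a| <= c) ->
  `|spread (coef f) k| <= c.
Proof.
by move=> fc; apply: (spread_le fc) => //; apply: le_trans (fc xpredT).
Qed.

(** A nonlinear choice of representatives for the linear map to come. *)
Definition walsh_transfer f : linf R := to_linf (spread (coef f)).

Lemma walsh_transferE f : walsh_transfer f = spread (coef f) :> (nat -> R).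
Proof.
apply: (@to_linfE _ _ `|f|) => k; apply: spread_coef_le => a.
by apply: coefficient_bound => // j; exact: linf_ge.
Qed.

Lemma c0P f :
  (forall e : R, 0 < e -> exists N : nat, forall k, (N <= k)%N -> `|f k| <= e) ->
  f \in c0.
Proof.
move=> H; apply: mem_set; apply/cvgr0Pnorm_le => e e0.
by have [N NP] := H e e0; exists N.
Qed.

Lemma c0_eventually f (e : R) : f \in c0 -> 0 < e ->
  exists N : nat, forall k, (N <= k)%N -> `|f k| <= e.
Proof.
by move=> /set_mem /cvgr0Pnorm_le H e0; have [N _ NP] := H e e0; exists N.
Qed.

Lemma walsh_transfer_linear (c : R) f g :
  class_c0 (walsh_transfer (c *: f + g)) =
    c *: class_c0 (walsh_transfer f) + class_c0 (walsh_transfer g).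
Proof.
rewrite -linearP; apply/class_c0P; apply: c0P => e e0.
have cf := coef_c0_family f; have cg := coef_c0_family g.
have E : coef (c *: f + g) = fun a => c * coef f a + coef g a.
  by apply/funext => a; rewrite -coefficient_linear.
have cfg := coef_c0_family (c *: f + g); rewrite E in cfg.
have [N NP] := spread_linear cf cg cfg e0.
exists N => k kN; rewrite linfB linfD linfZ !walsh_transferE E.
exact: NP.
Qed.

Lemma walsh_transfer_class f g : class_c0 f = class_c0 g ->
  walsh_transfer f = walsh_transfer g.
Proof.
move=> /class_c0P /set_mem fg; rewrite /walsh_transfer; congr (to_linf (spread _)).
apply/funext => a; apply/eqP; rewrite -subr_eq0; apply/eqP.
have := coefficient_vanish UU Uoo a (linf_is_bounded (f - g)) fg.
have -> : coefficient U (f - g) a = coefficient U (fun k => -1 * g k + f k) a.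
  by congr (coefficient U _ a); apply/funext => k; rewrite linfB mulN1r addrC.
by rewrite coefficient_linear// mulN1r addrC.
Qed.

Definition walsh_operator (x : linf_c0 R) : linf_c0 R :=
  class_c0 (walsh_transfer (repr x)).

Lemma walsh_operatorE f : walsh_operator (class_c0 f) = class_c0 (walsh_transfer f).
Proof.
by congr class_c0; apply: walsh_transfer_class; exact: reprK.
Qed.

Lemma walsh_operator_linear : linear walsh_operator.
Proof.
move=> c x y; have [f <-] := class_c0_surj x; have [g <-] := class_c0_surj y.
by rewrite -linearP !walsh_operatorE walsh_transfer_linear.
Qed.

HB.instance Definition _ := GRing.isLinear.Build R (linf_c0 R) (linf_c0 R) _
  walsh_operator walsh_operator_linear.

Lemma walsh_operator_bounded x : `|walsh_operator x| <= `|x|.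
Proof.
apply/ler_addgt0Pr => e e0.
have [f <- fe] := linf_c0_norm_approx x e0.
rewrite walsh_operatorE; apply: le_trans (linf_c0_norm_lb _) _.
apply: le_trans (ltW fe); apply: linf_le => k; rewrite walsh_transferE.
apply: spread_coef_le => a; apply: coefficient_bound => // j; exact: linf_ge.
Qed.

(** The image consists of sequences supported by the branches, where the mean
    vanishes. *)
Lemma walsh_operator_sqr0 x : walsh_operator (walsh_operator x) = 0.
Proof.
have [f <-] := class_c0_surj x; rewrite !walsh_operatorE.
suff -> : walsh_transfer (walsh_transfer f) = 0 by rewrite linear0.
apply/val_inj/funext => k; rewrite -[LHS]/(walsh_transfer (walsh_transfer f) k).
rewrite walsh_transferE; apply/normr0_eq0/eqP; rewrite -normr_le0 normr_id.
apply: spread_coef_le => a.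
suff -> : coef (walsh_transfer f) a = 0 by rewrite normr0.
rewrite -(mean_cst UU 0); congr (lim (_ @ U)); apply/funext => n.
apply: eq_average => s; rewrite walsh_transferE.
suff -> : spread (coef f) (pickle (true, s)) = 0 by rewrite mul0r.
apply/normr0_eq0/eqP; rewrite -normr_le0 normr_id.
have [[M bM] _] := coef_c0_family f.
by apply: (spread_le bM) => // b [m] /(pcan_inj (@pickleK _)) [].
Qed.

Lemma automorphism_add_sqr0 :
  automorphism (idfun \+ walsh_operator : {linear linf_c0 R -> linf_c0 R}).
Proof.
split.
  exists 2 => x; apply: le_trans (ler_normD _ _) _ => /=.
  by have := walsh_operator_bounded x; lra.
exists (idfun \- walsh_operator : {linear linf_c0 R -> linf_c0 R}); split=> [|x|x] /=.
- exists 2 => x; apply: le_trans (ler_normB _ _) _ => /=.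
  by have := walsh_operator_bounded x; lra.
- by rewrite linearD /= walsh_operator_sqr0 addr0 addrK.
- by rewrite linearB /= walsh_operator_sqr0 subr0 subrK.
Qed.

Lemma walsh_operator_no_lift (L : {linear linf R -> linf R}) :
  bounded_operator L ->
  (forall f, walsh_operator (class_c0 f) = class_c0 (L f)) -> False.
Proof.
move=> [C LC] lift.
have near f (e : R) : 0 < e -> exists N : nat, forall n, (N <= n)%N ->
    `|L f n - spread (coef f) n| <= e.
  move=> e0; have := lift f; rewrite walsh_operatorE => /esym/class_c0P/c0_eventually.
  by move=> /(_ e e0)[N NP]; exists N => n /NP; rewrite linfB walsh_transferE.
have wE a : to_linf (walsh_seq R a) = walsh_seq R a :> (nat -> R).
  exact: (to_linfE (walsh_seq_le1 R a)).
apply: (@no_operator_separating_branches R L C LC (mean U) 1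
  (fun a => to_linf (walsh_seq R a)) branch).
- exact: mean_positive.
- move=> f e e0 fe; have [N NP] := near f e e0; exists N => n /NP h.
  have : `|spread (coef f) n| <= e.
    by apply: spread_coef_le => a; apply: coefficient_le => //; exact: ltW.
  move: h; rewrite !ler_norml => /andP[? ?] /andP[? ?]; apply/andP; split; lra.
- by move=> a k; rewrite wE walsh_seq_le1.
- exact: branch_infinite.
- move=> a b e e0; have [N NP] := near (to_linf (walsh_seq R b)) e e0.
  have E : coef (to_linf (walsh_seq R b)) = fun a => (`[< a = b >])%:R.
    apply/funext => c; rewrite /coefficient wE mean_walsh//.
    by congr (nat_of_bool _)%:R; apply/asbool_equiv_eq; split=> ->.
  rewrite E in NP; have [N' N'P] := branches_separated [:: a; b].
  exists (maxn N N') => n; rewrite geq_max => /andP[/NP h nN'] an.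
  move: h; rewrite spread_delta; have [ab|ab] := pselect (a = b).
    by rewrite (asboolT ab) charT// -ab.
  rewrite (asboolF ab) charF// => bn; apply: ab.
  by apply: (N'P n nN') => //; rewrite !inE eqxx ?orbT.
Qed.

Lemma non_liftable_automorphism :
  exists T : {linear linf_c0 R -> linf_c0 R},
    automorphism T /\
    ~ exists L : {linear linf R -> linf R},
        [/\ bounded_operator L,
            forall f : linf R, f \in c0 -> L f \in c0
          & forall f : linf R, T (class_c0 f) = class_c0 (L f)].
Proof.
exists (idfun \+ walsh_operator : {linear linf_c0 R -> linf_c0 R}).
split; first exact: automorphism_add_sqr0.
move=> [L [[C LC] _ lift]].
apply: (walsh_operator_no_lift (L := L \- idfun : {linear linf R -> linf R})).
  exists (C + 1) => f /=; apply: le_trans (ler_normB _ _) _.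
  by rewrite mulrDl mul1r lerD2r; exact: LC.
move=> f; have -> : class_c0 ((L \- idfun) f) = class_c0 (L f) - class_c0 f.
  exact: (linearB class_c0).
by rewrite -lift /= addrC addKr.
Qed.

End Operator.

Theorem theorem4p16 (R : realType) :
  exists T : {linear linf_c0 R -> linf_c0 R},
    automorphism T /\
    ~ exists L : {linear linf R -> linf R},
        [/\ bounded_operator L,
            forall f : linf R, f \in c0 -> L f \in c0
          & forall f : linf R, T (class_c0 f) = class_c0 (L f)].
Proof.
have [U [UU Uoo]] := ultraFilterLemma (eventually_filter : ProperFilter \oo).
exact: (non_liftable_automorphism R UU Uoo).
Qed.
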